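(* Let $n\ge2$ and let $D\subset\mathbf{R}^n$ be a bounded open region. Assume that $-\Delta_n u=V|u|^{n-2}u$ has a nontrivial (real-valued) solution $u\in W_0^{1,n}(D)$, with $V\in L\log^{n-1}L(D)$. Then $$K_M\,|D|\,\|V_+\|_N\ge1 .$$ Moreover, let $u_*\in W_0^{1,n}(D)$ be a nonnegative extremal for the Moser–Trudinger type inequality defining $K_M$, normalized by $\|\nabla u_*\|_n=1$, i.e. $u_*\ge0$ and $\int_D M(u_*^n)\,dx=K_M|D|$, and let $$V(x)=\frac{M'(u_*^n(x))}{\int_D M'(u_*^n)\,u_*^n\,dx}.$$ Then $-\Delta_n u_*=V u_*^{n-1}$ and equality $K_M|D|\,\|V_+\|_N=1$ is attained.
   Context: $\Delta_n u=\mathrm{div}(|\nabla u|^{n-2}\nabla u)$, and solutions are in the distribution sense: $\int_D|\nabla u|^{n-2}\nabla u\cdot\nabla\psi\,dx=\int_D V|u|^{n-2}u\,\psi\,dx$ for all $\psi\in C_0^\infty(D)$. $V$ is real-valued, $V_+=\max(V,0)$. $|D|$ is the Lebesgue measure of $D$. Let $\alpha_n=(n^{n-1}\omega_n)^{1/n}$ with $\omega_n$ the surface area of the unit sphere in $\mathbf{R}^n$, and fix a constant $0<\alpha<(\alpha_n)^n$. Define $$M(t)=\int_0^{\alpha t}\bigl(e^{s^{1/(n-1)}}-1\bigr)ds,\qquad N(s)=\int_0^{s/\alpha}\log^{n-1}(t+1)\,dt .$$ $K_M$ is the optimal (smallest) constant, depending on $D$, such that $\int_D M\bigl(|u(x)|^n/\|\nabla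 u\|_n^n\bigr)dx\le K_M|D|$ for all real-valued $0\ne u\in W_0^{1,n}(D)$; it is finite and a nonnegative normalized extremal exists. $L\log^{n-1}L(D)$ is the Orlicz space of measurable $V$ with $\int_D|V|\log^{n-1}(1+|V|)\,dx<\infty$, with norm $$\|V\|_N=\inf\Bigl\{\lambda+\frac{\lambda}{K_M|D|}\int_D N\Bigl(\frac{|V(x)|}{\lambda}\Bigr)dx:\ \lambda>0\Bigr\}.$$ *)

(* Defs.v *)
From HB Require Import structures.
From mathcomp Require Import all_boot all_order all_algebra.
From mathcomp Require Import all_classical all_reals all_analysis.

Set Implicit Arguments.
Unset Strict Implicit.
Unset Printing Implicit Defensive.

Import Order.TTheory GRing.Theory Num.Theory.
Import numFieldNormedType.Exports.

Local Open Scope classical_set_scope.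
Local Open Scope ring_scope.

(* R^n is 'rV[R]_n. Its library topology is the usual one, but its library norm
   is the sup norm, hence the separate Euclidean norm [enorm] below. *)

(* Lebesgue outer measure, from countable covers by half-open boxes ]a, b].
   [None] stands for the empty set: it makes the outer measure of set0 equal to
   0 also in dimension 0, where no box is empty. *)
Section lebesgue_outer.
Context {R : realType} {n : nat}.

Definition box (p : option ('rV[R]_n * 'rV[R]_n)) : set 'rV[R]_n :=
  if p is Some (a, b) then [set x | forall i, a 0 i < x 0 i <= b 0 i] else set0.

Definition box_vol (p : option ('rV[R]_n * 'rV[R]_n)) : \bar R :=
  if p is Some (a, b) then (\prod_i Num.max 0 (b 0 i - a 0 i))%:E else 0%E.

Definition box_cover (A : set 'rV[R]_n) :=
  [set F : nat -> option ('rV[R]_n * 'rV[R]_n) | A `<=` \bigcup_k box (F k)].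

Definition lebesgue_outer (A : set 'rV[R]_n) : \bar R :=
  ereal_inf [set (\sum_(0 <= k <oo) box_vol (F k))%E | F in box_cover A].

End lebesgue_outer.

Section lebesgue_rV.
Context (R : realType) (n : nat).
Local Open Scope ereal_scope.
Implicit Types A : set 'rV[R]_n.
Local Notation mu := (@lebesgue_outer R n).

Lemma box_vol_ge0 (p : option ('rV[R]_n * 'rV[R]_n)) : 0 <= box_vol p.
Proof.
case: p => [[a b]|] //=; rewrite lee_fin.
by apply: prodr_ge0 => i _; rewrite le_max lexx.
Qed.

Lemma lebesgue_outer_ge0 A : 0 <= mu A.
Proof.
apply: le_ereal_inf_tmp => x [F _ <-].
by apply: nneseries_ge0 => k _ _; exact: box_vol_ge0.
Qed.

Lemma lebesgue_outer0 : mu set0 = 0.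
Proof.
apply/eqP; rewrite eq_le lebesgue_outer_ge0 andbT.
apply: ereal_inf_lbound; exists (fun=> None) => //.
by rewrite eseries0.
Qed.

Lemma le_lebesgue_outer : {homo mu : A B / A `<=` B >-> A <= B}.
Proof.
move=> A B AB; apply/ereal_inf_le_tmp => x [F BF <-].
by exists F => //; exact: subset_trans BF.
Qed.

Lemma lebesgue_outer_sigma_subadditive : sigma_subadditive mu.
Proof.
move=> A; have [[i ioo]|] := pselect (exists i, mu (A i) = +oo).
  rewrite (eseries_pinfty _ _ ioo) ?leey// => k _.
  by rewrite -ltNye (lt_le_trans _ (lebesgue_outer_ge0 _)).
rewrite -forallNE => Aoo.
apply/lee_addgt0Pr => _/posnumP[e].
rewrite (le_trans _ (epsilon_trick _ _ _))//; last first.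
  by move=> k; exact: lebesgue_outer_ge0.
pose P k (F : nat -> option ('rV[R]_n * 'rV[R]_n)) := box_cover (A k) F /\
  \sum_(0 <= j <oo) box_vol (F j) <= mu (A k) + (e%:num / (2 ^ k.+1)%:R)%:E.
have [G PG] : {G : nat -> nat -> option ('rV[R]_n * 'rV[R]_n) &
    forall k, P k (G k)}.
  apply: (@choice _ _ P) => k; rewrite /P /lebesgue_outer.
  set S := (X in ereal_inf X); move infS : (ereal_inf S) => iS.
  case: iS infS => [r Sr|Soo|Soo].
  - have en1 : (0 < e%:num / (2 ^ k.+1)%:R)%R by [].
    have /(lb_ereal_inf_adherent en1) : ereal_inf S \is a fin_num by rewrite Sr.
    move=> [x [F AF vFx] xS].
    by exists F; split => //; rewrite vFx -Sr; exact/ltW.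
  - by have := Aoo k; rewrite /lebesgue_outer -/S Soo.
  - by have := lebesgue_outer_ge0 (A k); rewrite /lebesgue_outer -/S Soo.
have vG_ge0 x : 0 <= (box_vol \o uncurry G) x by exact: box_vol_ge0.
apply: (@le_trans _ _ (\esum_(i in setT) (box_vol \o uncurry G) i)).
  apply: ereal_inf_lbound => /=.
  have /card_esym/ppcard_eqP[f] := card_nat2.
  exists (uncurry G \o f).
    move=> t [i _] /(PG i).1[j _ Gij].
    by exists (f^-1%FUN (i, j)) => //=; rewrite invK ?inE.
  rewrite -(esum_pred_image (box_vol \o uncurry G) _ xpredT) ?[fun=> _]set_true//.
  by rewrite image_eq.
rewrite (_ : esum _ _ = \sum_(i <oo) \sum_(j <oo) box_vol (G i j)); last first.
  pose J : nat -> set (nat * nat) := fun i => [set (i, j) | j in setT].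
  rewrite (_ : setT = \bigcup_k J k); last first.
    by rewrite predeqE => -[a b]; split => // _; exists a => //; exists b.
  rewrite esum_bigcupT /=; last 2 first.
    - apply/trivIsetP => i j _ _ ij.
      rewrite predeqE => -[k m] /=; split => //= -[] [_] _ [<-{k} _].
      by move=> [m' _] [] /esym/eqP; rewrite (negbTE ij).
    - by move=> /= [k m]; exact: box_vol_ge0.
  rewrite -(image_id [set: nat]) -fun_true esum_pred_image//; last first.
    by move=> k _; apply: esum_ge0 => ? _; exact: box_vol_ge0.
  apply: eq_eseriesr => /= j _.
  rewrite -(esum_pred_image (box_vol \o uncurry G) (pair j) predT)//=; last 2 first.
    by move=> ? _; exact: box_vol_ge0.
    by move=> ? ? _ _; exact: (@can_inj _ _ _ snd).
  by congr esum; rewrite predeqE => -[a b]; split; move=> [i _ <-]; exists i.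
apply: lee_nneseries => k *.
  by apply: nneseries_ge0 => m *; exact: (vG_ge0 (k, m)).
exact: (PG k).2.
Qed.

HB.instance Definition _ := isOuterMeasure.Build R 'rV[R]_n mu
  lebesgue_outer0 lebesgue_outer_ge0 le_lebesgue_outer
  lebesgue_outer_sigma_subadditive.

(* The measurable sets of R^n are the Lebesgue measurable ones. *)
HB.instance Definition _ := @isMeasurable.Build (caratheodory_display mu)
  'rV[R]_n mu.-caratheodory
    (caratheodory_measurable_set0 mu)
    (@caratheodory_measurable_setC _ _ mu)
    (@caratheodory_measurable_bigcup _ _ mu).

Definition lebesgue_rV : set 'rV[R]_n -> \bar R := mu.

HB.instance Definition _ := isMeasure.Build _ _ _ lebesgue_rV
  (@caratheodory_measure0 R 'rV[R]_n mu)
  (@caratheodory_measure_ge0 R 'rV[R]_n mu)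
  (@caratheodory_measure_sigma_additive R 'rV[R]_n mu).

End lebesgue_rV.
Arguments lebesgue_rV {R n}.

Section euclidean.
Context {R : realType} {n : nat}.

Definition dotp (v w : 'rV[R]_n) : R := \sum_i v 0 i * w 0 i.

Definition enorm (v : 'rV[R]_n) : R := Num.sqrt (dotp v v).

(* Surface measure on the unit sphere, from the polar decomposition
   dx = r^(n-1) dr d(sigma): the cone ]0, 1].E has measure sigma(E) / n. *)
Definition sphere_measure (E : set 'rV[R]_n) : \bar R :=
  (n%:R%:E * lebesgue_rV [set (rt.1 *: rt.2)%R | rt in `]0%R, 1%R] `*` E])%E.

Definition sphere_area : R := fine (sphere_measure [set v | enorm v = 1]).

Definition alpha_crit : R := (n%:R ^+ n.-1 * sphere_area) `^ n%:R^-1.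

Definition volume (D : set 'rV[R]_n) : R := fine (lebesgue_rV D).

Definition ebasis (i : 'I_n) : 'rV[R]_n := delta_mx 0 i.

Definition gradient (f : 'rV[R]_n -> R) (x : 'rV[R]_n) : 'rV[R]_n :=
  \row_i 'D_(ebasis i) f x.

Definition iter_partial (s : seq 'I_n) (f : 'rV[R]_n -> R) : 'rV[R]_n -> R :=
  foldr (fun i g => 'D_(ebasis i) g) f s.

Definition smooth (f : 'rV[R]_n -> R) := forall s : seq 'I_n,
  continuous (iter_partial s f) /\
  forall i x, derivable (iter_partial s f) x (ebasis i).

Definition support (f : 'rV[R]_n -> R) : set 'rV[R]_n :=
  closure [set x | f x != 0].

Definition test_function (D : set 'rV[R]_n) (f : 'rV[R]_n -> R) :=
  [/\ smooth f, compact (support f) & support f `<=` D].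

End euclidean.
Arguments alpha_crit R n : clear implicits.

(* Below, elements of Sobolev spaces are functions on R^n considered up to a.e.
   equality on D only; [du] is the gradient of [u], unique up to a.e. equality
   on D. *)
Section sobolev.
Context {R : realType} {n : nat}.
Variable D : set 'rV[R]_n.
Local Notation mu := (@lebesgue_rV R n).

Definition weak_gradient (u : 'rV[R]_n -> R) (du : 'rV[R]_n -> 'rV[R]_n) :=
  forall psi, test_function D psi -> forall i,
    \int[mu]_(x in D) (u x * 'D_(ebasis i) psi x) =
    - \int[mu]_(x in D) (du x 0 i * psi x).

Definition W1n (u : 'rV[R]_n -> R) (du : 'rV[R]_n -> 'rV[R]_n) :=
  [/\ measurable_fun D u,
      forall i, measurable_fun D (fun x => du x 0 i),
      (\int[mu]_(x in D) (`|u x| ^+ n)%:E < +oo)%E,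
      (\int[mu]_(x in D) (enorm (du x) ^+ n)%:E < +oo)%E &
      weak_gradient u du].

Definition W1n0 (u : 'rV[R]_n -> R) (du : 'rV[R]_n -> 'rV[R]_n) :=
  W1n u du /\
  exists phi : nat -> 'rV[R]_n -> R,
    [/\ forall k, test_function D (phi k),
        (\int[mu]_(x in D) (`|phi k x - u x| ^+ n)%:E @[k --> \oo] --> 0)%E &
        (\int[mu]_(x in D) (enorm (gradient (phi k) x - du x) ^+ n)%:E
           @[k --> \oo] --> 0)%E].

Definition nontrivial (u : 'rV[R]_n -> R) :=
  ~ {ae mu, forall x, D x -> u x = 0}.

Definition grad_norm (du : 'rV[R]_n -> 'rV[R]_n) : R :=
  (\int[mu]_(x in D) (enorm (du x) ^+ n)) `^ n%:R^-1.

(* -Delta_n u = f in the distribution sense, where du is the gradient of u. *)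
Definition n_laplace_eq (du : 'rV[R]_n -> 'rV[R]_n) (f : 'rV[R]_n -> R) :=
  forall psi, test_function D psi ->
    let lhs x := enorm (du x) ^+ (n - 2) * dotp (du x) (gradient psi x) in
    let rhs x := f x * psi x in
    [/\ mu.-integrable D (EFin \o lhs), mu.-integrable D (EFin \o rhs) &
        \int[mu]_(x in D) lhs x = \int[mu]_(x in D) rhs x].

End sobolev.

Section moser_trudinger.
Context {R : realType} (n : nat) (alpha : R).
Local Notation mu := (@lebesgue_rV R n).

Definition fM (t : R) : R := \int[lebesgue_measure]_(s in `[0, alpha * t])
  (expR (s `^ (n.-1%:R)^-1) - 1).

Definition fN (s : R) : R := \int[lebesgue_measure]_(t in `[0, s / alpha])
  (ln (t + 1) ^+ n.-1).

Definition moser_trudinger_bound (D : set 'rV[R]_n) (K : R) :=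
  forall u du, W1n0 D u du -> nontrivial D u ->
    (\int[mu]_(x in D) (fM (`|u x| ^+ n / grad_norm D du ^+ n))%:E
       <= K%:E * mu D)%E.

Definition optimal_constant (D : set 'rV[R]_n) (K : R) :=
  moser_trudinger_bound D K /\
  forall K', moser_trudinger_bound D K' -> K <= K'.

Definition in_LlogL (D : set 'rV[R]_n) (V : 'rV[R]_n -> R) :=
  measurable_fun D V /\
  (\int[mu]_(x in D) (`|V x| * ln (1 + `|V x|) ^+ n.-1)%:E < +oo)%E.

Definition norm_N (D : set 'rV[R]_n) (K : R) (V : 'rV[R]_n -> R) : \bar R :=
  ereal_inf [set (l%:E + (l / (K * volume D))%:E *
                   \int[mu]_(x in D) (fN (`|V x| / l))%:E)%E
             | l in [set l : R | 0 < l]].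

Definition extremal (D : set 'rV[R]_n) (K : R) (u : 'rV[R]_n -> R)
    (du : 'rV[R]_n -> 'rV[R]_n) :=
  [/\ W1n0 D u du,
      {ae mu, forall x, D x -> 0 <= u x},
      grad_norm D du = 1 &
      (\int[mu]_(x in D) (fM (u x ^+ n))%:E = K%:E * mu D)%E].

Definition extremal_potential (D : set 'rV[R]_n) (u : 'rV[R]_n -> R)
    (x : 'rV[R]_n) : R :=
  derive1 fM (u x ^+ n) /
    \int[mu]_(y in D) (derive1 fM (u y ^+ n) * u y ^+ n).

End moser_trudinger.

Definition pos_part {R : realType} {n : nat} (V : 'rV[R]_n -> R)
  (x : 'rV[R]_n) : R := Num.max (V x) 0.

(* Main.v *)
(* For t >= 0, fM and fN are convex conjugates: s t <= fM s + fN t, with equality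
   when t = fM' s. Applied with s = |w|^n / ||grad w||_n^n and integrated, this and
   the inequality defining K give, for w in W_0^{1,n} and f >= 0,
     int f |w|^n <= ||grad w||_n^n (K |D| + int fN(f)).                     (Y)
   Testing the equation with u itself (by approximation; (Y) makes the potential
   term continuous on W_0^{1,n}) gives ||grad u||_n^n = int V |u|^n, and (Y) with
   f = V_+ / lambda bounds this by ||grad u||_n^n K |D| ||V_+||_N.
   For an extremal u and f = fM'(u^n), equality in Young's inequality turns the
   right factor of (Y) into A = int f u^n, so that w -> A ||grad w||_n^n - int f |w|^n
   is nonnegative and vanishes at w = u; its first variation at u is the
   Euler-Lagrange equation. That A is finite follows from the inequality defining K
   as well, because u is approximated in W^{1,n} by bounded test functions. Moreover
   optimality of K forces W_0^{1,n} to contain a nontrivial function, since otherwise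
   K - 1 would be admissible too; this gives K > 0, and the inequality defining K
   then implies a Poincare inequality. *)
Require Import Defs.
From mathcomp Require Import all_boot all_order all_algebra.
From mathcomp Require Import all_classical all_reals all_analysis.
From mathcomp Require Import measurable_realfun ring lra.
Set Implicit Arguments.
Unset Strict Implicit.
Unset Printing Implicit Defensive.
Import Order.TTheory GRing.Theory Num.Theory.
Import numFieldNormedType.Exports.
Local Open Scope classical_set_scope.
Local Open Scope ring_scope.
(* MathComp's [support] would otherwise take precedence. *)
Local Notation support := Defs.support.

(** * Lebesgue measure on R^n *)

(** Division by 0 yields 0, so the inequality defining K says nothing about a function of zero
    energy. That such a function is trivial has to be proved: by a Poincare inequality for test
    functions, whose energy is positive by the mean value theorem, and then by approximation. The
    measure comes from an outer measure given by covers, and its value on a box is never computed.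
    Open sets are measurable, bounded sets have finite measure, translations preserve measure;
    positivity on nonempty open sets follows unless the whole space is null, and that would
    contradict the optimality of K. Translation invariance also gives integration by parts, so test
    functions lie in W_0^{1,n} with their classical gradient, and the variations u + c psi stay in
    that space. The Euler-Lagrange equation is obtained without differentiating the two integrals:
    convexity of |.|^n bounds the weighted term from below by its tangent at u, and the energy from
    above by its tangent at the varied function, which leaves one limit, that of the flux, to
    dominated convergence. *)

Lemma max0_sub_split (R : realDomainType) (a b c : R) :
  Num.max 0 (b - a) = Num.max 0 (Num.min b c - a) + Num.max 0 (b - Num.max a c).
Proof.
have [bc|cb] := leP b c; have [ac|ca] := leP a c.
- by rewrite [Num.max 0 (b - c)]max_l ?addr0 // subr_le0.
- rewrite !max_l ?addr0 ?subr_le0//; lra.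
- case: (leP b a) => ba.
   rewrite !max_l ?addr0 ?subr_le0//; lra.
  rewrite !max_r ?subr_ge0//; lra.
- by rewrite [Num.max 0 (c - a)]max_l ?add0r// subr_le0 ltW.
Qed.

Lemma ler_coord_norm {R : realType} {n : nat} (x : 'rV[R]_n) i :
  `|x 0 i| <= `|x|.
Proof.
rewrite [leRHS]/Num.norm/= mx_normrE.
exact: (le_bigmax _ (fun ij => `|x ij.1 ij.2|) (0, i)).
Qed.

Section lebesgue_rV_theory.
Context {R : realType} {n : nat}.
Implicit Types (A U : set 'rV[R]_n) (h : 'rV[R]_n).
Local Notation mu := (@lebesgue_rV R n).

(** The hyperplane cuts each box of a cover into two boxes that differ from it in one edge only.
    Their volumes add up to that of the box, so a cover of X yields covers of both pieces of X at no
    extra cost. *)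
Lemma measurable_half_space (i : 'I_n) (c : R) :
  measurable [set x : 'rV[R]_n | x 0 i <= c].
Proof.
apply: (@le_caratheodory_measurable _ _ (@lebesgue_outer R n)) => X.
apply: le_ereal_inf_tmp => _ [F XF <-].
pose F1 k := if F k is Some (a, b) then
  Some (a, \row_j (if j == i then Num.min (b 0 j) c else b 0 j)) else None.
pose F2 k := if F k is Some (a, b) then
  Some (\row_j (if j == i then Num.max (a 0 j) c else a 0 j), b) else None.
have F12 k : (box_vol (F k) = box_vol (F1 k) + box_vol (F2 k))%E.
  rewrite /F1 /F2; case: (F k) => [[a b]|]/=; last by rewrite adde0.
  have volE (p q : 'rV[R]_n) : \prod_j Num.max 0 (q 0 j - p 0 j) =
      Num.max 0 (q 0 i - p 0 i) * \prod_(j | j != i) Num.max 0 (q 0 j - p 0 j).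
    by rewrite (bigD1 i).
  rewrite -EFinD; congr EFin; rewrite !volE !mxE !eqxx.
  under [X in _ = _ * X + _]eq_bigr => j ji do rewrite !mxE (negbTE ji).
  under [X in _ = _ + _ * X]eq_bigr => j ji do rewrite !mxE (negbTE ji).
  by rewrite -mulrDl -max0_sub_split.
rewrite (eq_eseriesr (fun k _ => F12 k)) nneseriesD; last 2 first.
- by move=> k _ _; exact: box_vol_ge0.
- by move=> k _ _; exact: box_vol_ge0.
apply: leeD; apply: ereal_inf_lbound.
- exists F1 => // x [Xx xc]; have [k _ Fkx] := XF _ Xx.
  exists k => //; move: Fkx; rewrite /F1; case: (F k) => [[a b]|]//= + j.
  move=> /(_ j)/andP[-> xb]; rewrite mxE; case: eqP => [ji|_]//=.
  by rewrite le_min xb ji.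
- exists F2 => // x [Xx xc]; have [k _ Fkx] := XF _ Xx.
  exists k => //; move: Fkx; rewrite /F2; case: (F k) => [[a b]|]//= + j.
  move=> /(_ j)/andP[ax ->]; rewrite mxE andbT; case: eqP => [ji|_]//=.
  by rewrite gt_max ax ji ltNge; apply/negP.
Qed.

Lemma measurable_box (p : option ('rV[R]_n * 'rV[R]_n)) : measurable (box p).
Proof.
case: p => [[a b]|]; last exact: measurable0.
rewrite (_ : box _ = \bigcap_(i in [set: 'I_n])
    (~` [set x : 'rV[R]_n | x 0 i <= a 0 i] `&`
       [set x : 'rV[R]_n | x 0 i <= b 0 i])).
  apply: fin_bigcap_measurable => // i _; apply: measurableI.
    by apply: measurableC; exact: measurable_half_space.
  exact: measurable_half_space.
apply/seteqP; split => x /=.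
  by move=> xab i _ /=; have /andP[ax ->] := xab i; split => //; rewrite leNgt ax.
by move=> xab i; have [/= /negP + ->] := xab i I; rewrite -ltNge => ->.
Qed.

(* The half-open cubes of side 1 / (k + 1) with vertices on the lattice
   (k + 1)^-1 Z^n: for each k they are translates of each other and cover. *)
Definition grid_box (kz : nat * 'rV[int]_n) : set 'rV[R]_n :=
  box (Some (\row_i ((kz.2 0 i)%:~R / kz.1.+1%:R),
             \row_i (((kz.2 0 i)%:~R + 1) / kz.1.+1%:R))).

Lemma grid_box_cover k (x : 'rV[R]_n) : exists z, grid_box (k, z) x.
Proof.
(* The boxes are open on the left, hence the ceiling minus one instead of the floor. *)
exists (\row_i (Num.ceil (x 0 i * k.+1%:R) - 1)) => i /=; rewrite !mxE.
rewrite ltr_pdivrMr// ler_pdivlMr//.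
by have := ceil_itv (x 0 i * k.+1%:R); rewrite intrB subrK.
Qed.

Lemma grid_box_small k z x y : grid_box (k, z) x -> grid_box (k, z) y ->
  forall i, `|x 0 i - y 0 i| < k.+1%:R^-1.
Proof.
move=> xkz ykz i; have := xkz i; have := ykz i; rewrite /= !mxE.
rewrite !mulrDl !mul1r ltr_norml; move: (_^-1) (_%:~R / _) => c a.
by move=> /andP[? ?] /andP[? ?]; lra.
Qed.

Lemma open_grid_box {U} (x : 'rV[R]_n) : open U -> U x ->
  exists kz, grid_box kz x /\ grid_box kz `<=` U.
Proof.
move=> oU Ux; have /nbhs_ballP[e/= e0 xeU] : nbhs x U by exact: open_nbhs_nbhs.
have [k ke] : exists k : nat, (k.+1%:R)^-1 < e.
  by have [k _ ke] := near_infty_natSinv_lt (PosNum e0); exists k; exact: ke k (leqnn k).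
have [z zx] := grid_box_cover k x.
exists (k, z); split => // y zy; apply: xeU; split => // i j.
by rewrite ord1 /ball/= (lt_trans (grid_box_small zx zy j)).
Qed.

(** An open set is the union of the grid boxes that it contains, and the indices [kz] form a
    countable type. *)
Lemma open_measurable_rV U : open U -> measurable U.
Proof.
move=> oU.
rewrite (_ : U = \bigcup_kz (if `[< grid_box kz `<=` U >] then grid_box kz else set0)).
  apply: countable_bigcupT_measurable => // kz.
  by case: ifP => _; [exact: measurable_box|exact: measurable0].
apply/seteqP; split=> x.
  move=> Ux; have [kz [xkz kzU]] := open_grid_box oU Ux.
  by exists kz => //; case: asboolP.
by move=> [kz _]; case: asboolP => // + kzx; apply.
Qed.

Lemma continuous_measurable_rV (f : 'rV[R]_n -> R) D :
  continuous f -> measurable_fun D f.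
Proof.
move=> /continuousP cf; apply: (@measurable_funS _ _ _ _ setT) => //.
apply: (measurability _ (RGenOpens.measurableE R)) => _ [_ [a [b ->] <-]].
rewrite setTI; apply: open_measurable_rV; apply: cf.
exact: interval_open.
Qed.

Lemma bounded_lebesgue_rV_lty A : bounded_set A -> (lebesgue_outer A < +oo)%E.
Proof.
move=> [M [_ /(_ (M + 1))]]; rewrite ltrDl ltr01 => /(_ isT) AM.
pose F (k : nat) : option ('rV[R]_n * 'rV[R]_n) :=
  (* The lower corner lies one unit further out than the bound [M + 1], because the box omits its
     lower faces. *)
  if k is 0%N then Some (const_mx (- (M + 2)), const_mx (M + 1)) else None.
apply: (@le_lt_trans _ _ (\sum_(0 <= k <oo) box_vol (F k))%E).
  apply: ereal_inf_lbound; exists F => // x /AM /= xM; exists 0%N => // i.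
  rewrite !mxE.
  have : `|x 0 i| <= M + 1 by apply: le_trans xM; exact: ler_coord_norm.
  rewrite ler_norml; lra.
rewrite (nneseries_split 0%N 1%N); last by move=> k _; exact: box_vol_ge0.
by rewrite big_nat1 eseries0 ?adde0 ?ltry// => -[].
Qed.

Lemma le_lebesgue_outer_shift A h :
  (lebesgue_outer ((+%R^~ h) @^-1` A) <= lebesgue_outer A)%E.
Proof.
apply: le_ereal_inf_tmp => _ [F AF <-]; apply: ereal_inf_lbound.
exists (fun k => if F k is Some (a, b) then Some (a - h, b - h) else None).
  move=> x /AF[k _ Fk]; exists k => //; move: Fk; case: (F k) => [[a b]|]//= Fk i.
  by have := Fk i; rewrite !mxE ltrBlDr lerBrDr.
apply: eq_eseriesr => k _; case: (F k) => [[a b]|]//=; congr EFin.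
by apply: eq_bigr => i _; rewrite !mxE; congr Num.max; ring.
Qed.

Lemma lebesgue_outer_shift A h :
  lebesgue_outer ((+%R^~ h) @^-1` A) = lebesgue_outer A.
Proof.
apply/eqP; rewrite eq_le le_lebesgue_outer_shift/=.
have := le_lebesgue_outer_shift ((+%R^~ h) @^-1` A) (- h).
by rewrite -comp_preimage (_ : _ \o _ = id)// funeqE => x /=; rewrite subrK.
Qed.

(** Testing the translate of A on X is testing A on a translate of X, and the outer measure does not
    see the translation. *)
Lemma measurable_shift_rV h : measurable_fun [set: 'rV[R]_n] (+%R^~ h).
Proof.
move=> _ A mA; rewrite setTI.
suff : (@lebesgue_outer R n).-caratheodory ((+%R^~ h) @^-1` A) by [].
move=> X; have {mA} : (@lebesgue_outer R n).-caratheodory A by [].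
move=> /(_ ((+%R^~ (- h)) @^-1` X)).
have hK B : (+%R^~ h) @^-1` ((+%R^~ (- h)) @^-1` B) = B.
  by apply/seteqP; split => x /=; rewrite addrK.
rewrite -[in X in X = _ -> _](lebesgue_outer_shift _ h) hK => ->.
rewrite -[in X in (X + _)%E = _](lebesgue_outer_shift _ h).
rewrite -[in X in (_ + X)%E = _](lebesgue_outer_shift _ h).
by rewrite !preimage_setI hK preimage_setC.
Qed.

Lemma integral_shift_rV (f : 'rV[R]_n -> \bar R) h :
  measurable_fun setT f -> mu.-integrable setT (f \o +%R^~ h) ->
  (\int[mu]_x f (x + h)%R = \int[mu]_x f x)%E.
Proof.
move=> mf fi.
rewrite -[LHS](@integral_pushforward _ _ _ _ _ _ (measurable_shift_rV h) mu setT f)//.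
congr (integral _ _ _); apply/funext => A; exact: lebesgue_outer_shift.
Qed.

Lemma grid_box_translate k z : grid_box (k, z) =
  (+%R^~ (- \row_i ((z 0 i)%:~R / k.+1%:R))) @^-1` grid_box (k, 0).
Proof.
apply/seteqP; split => x /= xz i; have := xz i; rewrite !mxE/=;
  rewrite !mulrDl mul0r add0r mul1r; move: (_^-1) (_%:~R / _) => c a; lra.
Qed.

(** A nonempty open set contains a grid box. If that box were null, so would be its translates of
    the same size, and countably many of them cover the space. *)
Lemma lebesgue_rV_open_gt0 U : mu setT != 0%E -> open U -> U !=set0 ->
  (0 < mu U)%E.
Proof.
move=> muT oU [x Ux]; rewrite lt_neqAle measure_ge0 andbT eq_sym.
apply: contra_neq muT => U0.
have [[k z] [_ kzU]] := open_grid_box oU Ux.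
have kz0 : mu (grid_box (k, z)) = 0%E.
  by apply/eqP; rewrite eq_le measure_ge0 andbT -U0 le_outer_measure.
have k0 : mu (grid_box (k, 0)) = 0%E.
  by rewrite -kz0 grid_box_translate; exact/esym/lebesgue_outer_shift.
have k'0 z' : mu (grid_box (k, z')) = 0%E.
  by rewrite -k0 grid_box_translate; exact: lebesgue_outer_shift.
apply/negligibleP; first exact: measurableT.
pose F m := if unpickle m is Some z' then grid_box (k, z') else set0.
apply: (@negligibleS _ _ _ _ (\bigcup_m F m)).
  move=> y _; have [z' yz'] := grid_box_cover k y.
  by exists (pickle z') => //; rewrite /F pickleK.
apply: negligible_bigcup => m; rewrite /F; case: unpickle => [z'|].
  by apply/negligibleP; [exact: measurable_box|exact: k'0].
exact: negligible_set0.
Qed.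

End lebesgue_rV_theory.

(** * The conjugate pair (fM, fN) *)

(** The point 0 is treated by hand, with a neighbourhood of radius e^(1/a): for an exponent below 1
    the power has no derivative there. *)
Lemma continuous_max0_powR {R : realType} (a : R) : 0 < a ->
  continuous (fun x : R => (Num.max x 0) `^ a).
Proof.
move=> a0 x; have [x0|x0|->] := ltgtP x 0.
- apply: near_cst_continuous; near=> z.
  rewrite max_r ?powR0 ?gt_eqF ?ltW//.
  by near: z; exact: lt_nbhsl.
- suff : derivable (fun z : R => Num.max z 0 `^ a) x 1.
    by move=> /derivable1_diffP/differentiable_continuous.
  have dx : derivable (fun z : R => z `^ a) x 1.
    by apply: derivable_powR; rewrite in_itv/= x0.
  apply: near_eq_derivable dx.
  near=> z; rewrite max_l// ltW//; near: z; exact: lt_nbhsr.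
- apply/cvgrPdist_lt => e e0.
  near=> z.
  rewrite maxxx powR0 ?gt_eqF// sub0r normrN ger0_norm ?powR_ge0//.
  have ze : z < e `^ a^-1 by near: z; apply: num_topology.nbhs0_lt; rewrite powR_gt0.
  rewrite -[ltRHS]powRr1 ?ltW// -[in ltRHS](mulVf (lt0r_neq0 a0)) powRrM.
  rewrite gt0_ltr_powR ?nnegrE ?powR_ge0// ?le_max ?lexx ?orbT//.
  by rewrite gt_max powR_gt0// andbT.
Unshelve. all: by end_near. Qed.

(** An integral starting at 0 would have only a one-sided derivative at 0. As g vanishes on the
    negative axis, the integral can be started at any [a] below both 0 and y, which makes y an
    interior point; for z < 0 the interval [[0, z]] is empty and both integrals are 0. *)
Lemma is_derive_Rintegral0 {R : realType} (f g : R -> R) (y : R) :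
  continuous g -> (forall s, s <= 0 -> g s = 0) ->
  (forall s, 0 <= s -> f s = g s) ->
  is_derive y 1 (fun z => \int[lebesgue_measure]_(s in `[0, z]) f s) (g y).
Proof.
move=> cg g0 fg; pose a := Num.min y 0 - 1.
have ay : a < y by rewrite /a ltrBlDr minElt; case: ifPn; rewrite -?leNgt; lra.
have a0 : a < 0 by rewrite /a ltrBlDr minElt; case: ifPn; rewrite -?leNgt; lra.
have ig b c : lebesgue_measure.-integrable `[b, c] (EFin \o g).
  apply: continuous_compact_integrable; first exact: segment_compact.
  exact: continuous_subspaceT.
have [] := @continuous_FTC1_closed R g a y (y + 1) _ (ig _ _) ay (cg y).
  by rewrite ltrDl.
rewrite derive1E => d1 d2.
apply: (@near_eq_is_derive _ _ _ (fun z => \int[lebesgue_measure]_(s in `[a, z]) g s)); last first.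
  by split.
near=> z.
have az : a < z by near: z; exact: lt_nbhsr.
have [z0|z0] := ltP z 0.
  rewrite [in RHS]set_itv_ge ?bnd_simp -?ltNge// Rintegral_set0.
  rewrite (@eq_Rintegral _ _ _ _ _ (cst 0)).
    by rewrite Rintegral_cst ?mul0r.
  by move=> s; rewrite inE/= in_itv/= => /andP[_ sz]; rewrite g0//; lra.
transitivity (\int[lebesgue_measure]_(s in `[0, z]) g s); last first.
  apply: eq_Rintegral => s; rewrite inE/= in_itv/= => /andP[s0 _].
  by rewrite fg.
rewrite -[RHS]Rintegral_itv_obnd_cbnd; last first.
  by apply: integrableS (ig 0 z) => //; exact: subset_itv_oc_cc.
rewrite -(@Rintegral_itvB _ _ (BLeft a) (BRight z) 0)// ?bnd_simp ?ltW//.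
rewrite [X in _ - X](@eq_Rintegral _ _ _ _ _ (cst 0)).
  by rewrite Rintegral_cst ?mul0r ?subr0.
by move=> s; rewrite inE/= in_itv/= => /andP[_ sz]; rewrite g0//; lra.
Unshelve. all: by end_near. Qed.

Lemma tangent_le {R : realType} (F dF : R -> R) :
  (forall x, is_derive x (1 : R) F (dF x)) -> {homo dF : x y / x <= y} ->
  forall a b, F a + dF a * (b - a) <= F b.
Proof.
move=> FdF ndF a b.
have cF : continuous F.
  by move=> x; apply/differentiable_continuous/derivable1_diffP; have [] := FdF x.
have [ab|ba] := leP a b.
  have [c] := MVT_segment ab (fun x _ => FdF x) (continuous_subspaceT cF).
  rewrite in_itv/= => /andP[ac cb] /eqP; rewrite subr_eq => /eqP ->.
  by rewrite addrC lerD2r ler_wpM2r ?subr_ge0// ndF.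
have [c] := MVT_segment (ltW ba) (fun x _ => FdF x) (continuous_subspaceT cF).
rewrite in_itv/= => /andP[bc ca] /eqP; rewrite subr_eq => /eqP ->.
have := ndF _ _ ca; nra.
Qed.

Section young_pair.
Context {R : realType} (n : nat) (alpha : R).
Hypotheses (n_ge2 : (2 <= n)%N) (alpha_gt0 : 0 < alpha).

(** The derivative of [fM] in closed form. The truncation extends it by 0 to negative arguments, so
    that it is nondecreasing on the whole line and the tangent inequalities carry no sign condition.
    [dN] plays the same role for [fN]. *)
Definition dM (t : R) : R :=
  alpha * (expR (Num.max (alpha * t) 0 `^ (n.-1%:R)^-1) - 1).

Definition dN (s : R) : R := alpha^-1 * ln (Num.max (s / alpha) 0 + 1) ^+ n.-1.

Let n1_gt0 : (0 < n.-1)%N. Proof. by rewrite -subn1 subn_gt0. Qed.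

Let invn1_gt0 : 0 < (n.-1%:R)^-1 :> R. Proof. by rewrite invr_gt0 ltr0n. Qed.

Let continuous_max0 : continuous (fun x : R => Num.max x 0).
Proof. by move=> x; apply: continuous_max; [exact: cvg_id|exact: cvg_cst]. Qed.

Let max0_ge0 (x : R) : 0 <= Num.max x 0.
Proof. by rewrite le_max lexx orbT. Qed.

Let max0_homo : {homo (fun x : R => Num.max x 0) : x y / x <= y}.
Proof. by move=> x y xy; rewrite ge_max !le_max xy lexx orbT. Qed.

Lemma is_derive_fM (t : R) : is_derive t 1 (fM n alpha) (dM t).
Proof.
pose g s := expR (Num.max s 0 `^ (n.-1%:R)^-1) - 1 : R.
rewrite /dM mulrC -/(g _).
apply: (@is_derive1_comp _ (fun z => \int[lebesgue_measure]_(s in `[0, z])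
  (expR (s `^ (n.-1%:R)^-1) - 1)) ( *%R alpha)); last first.
  by apply: is_derive_eq; rewrite ?scaler0 ?addr0 /GRing.scale/= ?mulr1.
apply: (@is_derive_Rintegral0 _ _ g).
- have ce : continuous (fun y : R => expR y - 1).
    by move=> y; apply: cvgB; [exact: continuous_expR|exact: cvg_cst].
  move=> s; apply: (@continuous_comp _ _ _ (fun z : R => Num.max z 0 `^ _)
    (fun y : R => expR y - 1)); last exact: ce.
  exact: continuous_max0_powR.
- by move=> s s0; rewrite /g max_r// powR0 ?gt_eqF// expR0 subrr.
- by move=> s s0; rewrite /g max_l.
Qed.

Lemma is_derive_fN (s : R) : is_derive s 1 (fN n alpha) (dN s).
Proof.
pose g t := ln (Num.max t 0 + 1) ^+ n.-1 : R.
rewrite /dN mulrC -/(g _).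
apply: (@is_derive1_comp _ (fun z => \int[lebesgue_measure]_(s in `[0, z])
  (ln (s + 1) ^+ n.-1)) ( *%R^~ alpha^-1)); last first.
  by apply: is_derive_eq; rewrite ?scaler0 ?addr0 ?add0r /GRing.scale/= ?mulr1.
apply: (@is_derive_Rintegral0 _ _ g).
- have c1 : continuous (fun y : R => y + 1).
    by move=> y; apply: cvgD; [exact: cvg_id|exact: cvg_cst].
  move=> t; apply: (@continuous_comp _ _ _
    (fun y : R => ln (Num.max y 0 + 1)) (fun y : R => y ^+ n.-1)).
    apply: (@continuous_comp _ _ _ (fun y : R => Num.max y 0 + 1) (@ln R)).
      apply: (@continuous_comp _ _ _ (fun y : R => Num.max y 0) (fun y : R => y + 1)).
        exact: continuous_max0.
      exact: c1.
    by apply: continuous_ln; rewrite ltr_wpDl// le_max lexx orbT.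
  exact: exprn_continuous.
- by move=> t t0; rewrite /g max_r// add0r ln1 expr0n gtn_eqF.
- by move=> t t0; rewrite /g max_l.
Qed.

Lemma derive1_fM : derive1 (fM n alpha) = dM.
Proof. by apply/funext => t; rewrite derive1E; have [_] := is_derive_fM t. Qed.

Lemma dM_homo : {homo dM : x y / x <= y}.
Proof.
move=> x y xy; apply: ler_wpM2l; first exact: ltW.
apply: lerB; last exact: lexx.
rewrite ler_expR; apply: ge0_ler_powR.
- by rewrite invr_ge0.
- by rewrite nnegrE max0_ge0.
- by rewrite nnegrE max0_ge0.
- by apply: max0_homo; rewrite ler_pM2l.
Qed.

Lemma dN_homo : {homo dN : x y / x <= y}.
Proof.
move=> x y xy; apply: ler_wpM2l; first by rewrite invr_ge0 ltW.
have ln0 z : 0 <= ln (Num.max (z / alpha) 0 + 1) by rewrite ln_ge0// lerDr max0_ge0.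
apply: lerXn2r; rewrite ?nnegrE//.
rewrite ler_ln ?posrE ?ltr_wpDl ?max0_ge0// lerD2r.
by apply: max0_homo; rewrite ler_pM2r ?invr_gt0.
Qed.

Lemma dM0 : dM 0 = 0.
Proof. by rewrite /dM mulr0 maxxx powR0 ?gt_eqF// expR0 subrr mulr0. Qed.

Lemma dN0 : dN 0 = 0.
Proof. by rewrite /dN mul0r maxxx add0r ln1 expr0n gtn_eqF// mulr0. Qed.

Lemma fM0 : fM n alpha 0 = 0.
Proof. by rewrite /fM mulr0 set_itv1 Rintegral_set1. Qed.

Lemma fN0 : fN n alpha 0 = 0.
Proof. by rewrite /fN mul0r set_itv1 Rintegral_set1. Qed.

Lemma dM_ge0 t : 0 <= dM t.
Proof.
apply: mulr_ge0; first exact: ltW.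
by rewrite subr_ge0 -[leLHS]expR0 ler_expR powR_ge0.
Qed.

Lemma dM_gt0 t : 0 < t -> 0 < dM t.
Proof.
move=> t0; apply: mulr_gt0 => //.
by rewrite subr_gt0 -[ltLHS]expR0 ltr_expR powR_gt0// lt_max mulr_gt0.
Qed.

Lemma dN_ge0 s : 0 <= dN s.
Proof.
apply: mulr_ge0; first by rewrite invr_ge0 ltW.
by rewrite exprn_ge0// ln_ge0// lerDr max0_ge0.
Qed.

Lemma fM_tangent a b : fM n alpha a + dM a * (b - a) <= fM n alpha b.
Proof. exact: tangent_le is_derive_fM dM_homo a b. Qed.

Lemma fN_tangent a b : fN n alpha a + dN a * (b - a) <= fN n alpha b.
Proof. exact: tangent_le is_derive_fN dN_homo a b. Qed.

Lemma fM_ge0 t : 0 <= fM n alpha t.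
Proof. by have := fM_tangent 0 t; rewrite fM0 dM0 mul0r addr0. Qed.

Lemma fN_ge0 s : 0 <= fN n alpha s.
Proof. by have := fN_tangent 0 s; rewrite fN0 dN0 mul0r addr0. Qed.

Lemma fM_homo : {homo fM n alpha : x y / x <= y}.
Proof.
move=> x y xy; apply: le_trans (fM_tangent x y).
by rewrite lerDl mulr_ge0 ?dM_ge0// subr_ge0.
Qed.

Lemma fM_gt0 t : 0 < t -> 0 < fM n alpha t.
Proof.
(* The tangent at 0 is horizontal and yields no strict inequality; the one at t / 2 has positive
   slope. *)
move=> t0; have := fM_tangent (t / 2) t; apply: lt_le_trans.
rewrite ltr_wpDl ?fM_ge0// mulr_gt0// ?dM_gt0; lra.
Qed.

Lemma continuous_fM : continuous (fM n alpha).
Proof.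
move=> x; apply/differentiable_continuous/derivable1_diffP.
by have [] := is_derive_fM x.
Qed.

Lemma continuous_fN : continuous (fN n alpha).
Proof.
move=> x; apply/differentiable_continuous/derivable1_diffP.
by have [] := is_derive_fN x.
Qed.

Lemma fN_le s : 0 <= s -> fN n alpha s <= dN s * s.
Proof. by move=> s0; have := fN_tangent s 0; rewrite fN0 sub0r mulrN subr_le0. Qed.

(** The tangent at s is evaluated at 2 s. This controls the product M'(s) s, which has the size of
    the extremal mass, by M itself at a doubled argument. *)
Lemma fM_double s : dM s * s <= fM n alpha (2 * s).
Proof.
apply: le_trans (fM_tangent s (2 * s)).
rewrite (_ : 2 * s - s = s); last by ring.
by rewrite lerDr fM_ge0.
Qed.

Let dM_expR (x : R) : 0 <= x -> dM (x ^+ n.-1 / alpha) = alpha * (expR x - 1).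
Proof.
move=> x0; rewrite /dM (mulrC alpha (_ / _)) divfK ?gt_eqF// max_l ?exprn_ge0//.
by rewrite -powR_mulrn// -powRrM mulfV ?powRr1// pnatr_eq0 -lt0n.
Qed.

Let dN_expR (x : R) : 0 <= x -> dN (alpha * (expR x - 1)) = x ^+ n.-1 / alpha.
Proof.
move=> x0; rewrite /dN mulrC (mulrC alpha) mulfK ?gt_eqF//.
by rewrite max_l ?subrK ?expRK// subr_ge0 -expR0 ler_expR.
Qed.

(* Written in the variable x = ln (1 + dM s / alpha), the defect [E] of Young's
   equality vanishes at 0 and has derivative 0; [dM] itself need not be
   differentiable at 0. *)
Let young_expR (x : R) : 0 <= x ->
  fM n alpha (x ^+ n.-1 / alpha) + fN n alpha (alpha * (expR x - 1)) =
  x ^+ n.-1 * (expR x - 1).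
Proof.
move=> x0; apply/eqP; rewrite -subr_eq0; apply/eqP.
pose E := (fM n alpha \o (fun z => z ^+ n.-1 * alpha^-1)) +
  (fN n alpha \o (fun z => alpha * (expR z - 1))) -
  (fun z : R => z ^+ n.-1 * (expR z - 1)).
pose dE z := dM (z ^+ n.-1 / alpha) * (n.-1%:R * z ^+ n.-2 / alpha) +
  dN (alpha * (expR z - 1)) * (alpha * expR z) -
  (z ^+ n.-1 * expR z + (expR z - 1) * (n.-1%:R * z ^+ n.-2)).
have EdE (z : R) : is_derive z (1 : R) (E : R -> R) (dE z).
  have dX : is_derive z (1 : R) (fun z : R => z ^+ n.-1) (n.-1%:R * z ^+ n.-2).
    rewrite (_ : (fun z => _) = (@id R) ^+ n.-1); last by rewrite exprfctE.
    by apply: is_derive_eq; rewrite /GRing.scale/= mulr1.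
  have dexp : is_derive z (1 : R) (fun z : R => expR z - 1) (expR z).
    rewrite (_ : (fun z => _) = @expR R - cst 1); last exact/funext.
    by apply: is_derive_eq; rewrite subr0.
  have dfM : is_derive z (1 : R) (fM n alpha \o (fun z : R => z ^+ n.-1 / alpha))
      (dM (z ^+ n.-1 / alpha) * (n.-1%:R * z ^+ n.-2 / alpha)).
    apply: is_derive1_comp (is_derive_fM _) _.
    rewrite (_ : (fun z => _) = alpha^-1 \*: (fun z : R => z ^+ n.-1)); last first.
      by apply/funext => y; rewrite mulrC.
    exact: (is_derive_eq (is_deriveZ _ dX)) (mulrC _ _).
  have dfN : is_derive z (1 : R) (fN n alpha \o (fun z : R => alpha * (expR z - 1)))
      (dN (alpha * (expR z - 1)) * (alpha * expR z)).
    have dg : is_derive z (1 : R) (fun z : R => alpha * (expR z - 1)) (alpha * expR z).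
      exact: is_deriveZ.
    exact: is_derive1_comp (is_derive_fN _) dg.
  exact: is_deriveB (is_deriveD dfM dfN) (is_deriveM dX dexp).
have cE : continuous E.
  by move=> z; apply/differentiable_continuous/derivable1_diffP; have [] := EdE z.
have [c] := MVT_segment x0 (fun z _ => EdE z) (continuous_subspaceT cE).
rewrite in_itv/= => /andP[c0 _].
have -> : dE c = 0.
  by rewrite /dE dM_expR// dN_expR//; field; rewrite gt_eqF.
rewrite mul0r => /eqP; rewrite subr_eq add0r => /eqP Ex.
rewrite -[LHS]/(E x) Ex /E /=.
rewrite -![(_ + _ : _ -> _) _]/(_ + _) /= -![(- _ : _ -> _) _]/(- _) /=.
by rewrite expR0 subrr !mulr0 expr0n gtn_eqF// mul0r fM0 fN0 !addr0 subrr.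
Qed.

Lemma dM_dN s : 0 <= s -> dM (dN s) = s.
Proof.
move=> s0; have sa : 0 <= s / alpha by rewrite divr_ge0// ltW.
have sE : s = alpha * (expR (ln (s / alpha + 1)) - 1).
  by rewrite lnK ?posrE ?ltr_wpDl// addrK mulrC divfK ?gt_eqF.
have ln0 : 0 <= ln (s / alpha + 1) by rewrite ln_ge0// lerDr.
by rewrite [in LHS]sE dN_expR// dM_expR// -sE.
Qed.

Lemma young_eq s : 0 <= s -> fM n alpha s + fN n alpha (dM s) = s * dM s.
Proof.
move=> s0; pose x := (alpha * s) `^ (n.-1%:R)^-1.
have x0 : 0 <= x by exact: powR_ge0.
have sE : s = x ^+ n.-1 / alpha.
  rewrite -powR_mulrn// -powRrM mulVf ?powRr1 ?pnatr_eq0 -?lt0n//.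
    by rewrite mulrC mulKf ?gt_eqF.
  by apply: mulr_ge0 => //; exact: ltW.
by rewrite sE dM_expR// young_expR// mulrA divfK ?gt_eqF.
Qed.

(** Any t >= 0 is the slope of [fM] at [dN t]. Equality holds at that point, and the tangent of [fM]
    there gives the inequality for every other s. *)
Lemma young_le s t : 0 <= t -> s * t <= fM n alpha s + fN n alpha t.
Proof.
move=> t0; have dt0 := dN_ge0 t.
have := fM_tangent (dN t) s; have := young_eq dt0; rewrite dM_dN//; lra.
Qed.

End young_pair.

(** * Test functions *)

Section directional.
Context {R : realType} {n : nat}.
Implicit Types (f g : 'rV[R]_n -> R) (x v : 'rV[R]_n).
Local Notation mu := (@lebesgue_rV R n).

Lemma is_derive_line f x v (t : R) : derivable f (x + t *: v) v ->
  is_derive t (1 : R) (fun s : R => f (x + s *: v)) ('D_v f (x + t *: v)).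
Proof.
move=> df.
have E : (fun h : R => h^-1 *: (((fun s : R => f (x + s *: v)) \o shift t) (h *: (1 : R)) -
    f (x + t *: v))) =
  (fun h : R => h^-1 *: ((f \o shift (x + t *: v)) (h *: v) - f (x + t *: v))).
  apply/funext => h /=; congr (_ *: (f _ - _)).
  by rewrite /= -[h *: (1 : R)]/(h * 1) mulr1 scalerDl addrCA.
by split; rewrite /derivable /derive E.
Qed.

Lemma MVT_line f x v (t : R) : 0 <= t -> (forall y, derivable f y v) ->
  exists2 c, 0 <= c <= t & f (x + t *: v) - f x = 'D_v f (x + c *: v) * t.
Proof.
move=> t0 df.
have dline s := is_derive_line (df (x + s *: v)).
have cl : continuous (fun s : R => f (x + s *: v)).
  by move=> s; apply/differentiable_continuous/derivable1_diffP; have [] := dline s.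
have [c] := MVT_segment t0 (fun s _ => dline s) (continuous_subspaceT cl).
rewrite in_itv/= => ct; rewrite scale0r addr0 subr0 => E.
by exists c.
Qed.

Lemma support_eq0 f x : ~ support f x -> f x = 0.
Proof.
move=> sfx; apply: contrapT => /eqP fx0; apply: sfx.
by apply: subset_closure; rewrite /= fx0.
Qed.

Lemma derive_support_eq0 f x v : ~ support f x -> 'D_v f x = 0.
Proof.
move=> sfx; rewrite (@near_eq_derive _ _ _ f (cst 0)) ?derive_cst//.
have : nbhs x (~` support f).
  by apply: open_nbhs_nbhs; split => //; apply/closed_openC/closed_closure.
by apply: filterS => y /support_eq0.
Qed.

Lemma continuous_support_bounded f (A : set 'rV[R]_n) : continuous f -> compact A ->
  (forall x, ~ A x -> f x = 0) -> exists2 M, 0 <= M & forall x, `|f x| <= M.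
Proof.
move=> cf cA f0.
have : compact (f @` A) by apply: continuous_compact => //; exact: continuous_subspaceT.
move=> /compact_bounded[M [_ /(_ (`|M| + 1))]].
rewrite (le_lt_trans (ler_norm _)) ?ltrDl// => /(_ isT) AM.
exists (`|M| + 1) => [|x]; first by rewrite addr_ge0.
have [Ax|/f0 ->] := pselect (A x); last by rewrite normr0 addr_ge0.
by apply: AM; exists x.
Qed.

Lemma bounded_integrable_rV (g : 'rV[R]_n -> R) (A : set 'rV[R]_n) C :
  measurable A -> (mu A < +oo)%E -> measurable_fun A g ->
  (forall x, A x -> `|g x| <= C) -> mu.-integrable A (EFin \o g).
Proof.
move=> mA Aoo mg gC; apply: measurable_bounded_integrable => //.
exists C; split; first exact: num_real.
by move=> x Cx y /gC /le_trans; apply; exact: ltW.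
Qed.

Lemma measurable_closed_ball_rV r : measurable [set x : 'rV[R]_n | `|x| <= r].
Proof.
rewrite -[X in measurable X]setCK; apply/measurableC/open_measurable_rV.
rewrite (_ : ~` _ = (fun x : 'rV[R]_n => `|x|) @^-1` `]r, +oo[%classic).
  apply: open_comp; last exact: interval_open.
  by move=> x _; exact: norm_continuous.
by apply/seteqP; split => x /=; rewrite in_itv/= andbT ltNge; move/negP.
Qed.

(** A directional derivative is a limit over nonzero increments, so the sequence has to converge in
    the punctured filter. *)
Lemma cvg_harmonic_dnbhs : (@harmonic R) k @[k --> \oo] --> (0 : R)^'.
Proof.
move=> A /= [e /= e0 eA].
suff : \forall k \near \oo, A (k.+1%:R^-1) by [].
near=> k; apply: eA => /=; last by rewrite gt_eqF ?invr_gt0.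
by rewrite sub0r normrN ger0_norm//; near: k; exact: near_infty_natSinv_lt (PosNum e0).
Unshelve. all: by end_near. Qed.

(* The difference quotients have integral 0 by translation invariance and are
   dominated by the sup of the partial derivative. *)
Lemma integral_derive_eq0 f (i : 'I_n) : continuous f ->
  (forall x, derivable f x (ebasis i)) -> continuous ('D_(ebasis i) f) ->
  compact (support f) -> (\int[mu]_x ('D_(ebasis i) f x)%:E = 0)%E.
Proof.
move=> cf df cdf kf; set v := ebasis i : 'rV[R]_n.
have [M M0 dfM] := continuous_support_bounded cdf kf (@derive_support_eq0 f ^~ v).
have [M' M'0 fM'] := continuous_support_bounded cf kf (@support_eq0 f).
have [r [_ /(_ (`|r| + 1))]] := compact_bounded kf.
rewrite (le_lt_trans (ler_norm _)) ?ltrDl// => /(_ isT) fr.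
(* The radius is enlarged by the norm of v, so that B contains the supports of f and of all its
   translates by h v with 0 <= h <= 1. *)
pose B := [set x : 'rV[R]_n | `|x| <= `|r| + 1 + `|v|].
have mB : measurable B := measurable_closed_ball_rV _.
have Boo : (mu B < +oo)%E.
  apply: bounded_lebesgue_rV_lty; exists (`|r| + 1 + `|v|); split; first exact: num_real.
  by move=> z rz x /= xr; rewrite (le_trans xr)// ltW.
pose q k x := k.+1%:R * (f (x + k.+1%:R^-1 *: v) - f x).
have f0 x : ~ B x -> f x = 0.
  move=> Bx; apply: support_eq0 => /fr /= xr; apply: Bx => /=.
  by apply: (le_trans xr); rewrite lerDl.
have h01 k : 0 <= (k.+1%:R^-1 : R) <= 1.
  by rewrite invr_ge0 ler0n/= invf_le1// ler1n.
have f0v h x : 0 <= h <= 1 -> ~ B x -> ~ support f (x + h *: v).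
  move=> /andP[h0 h1] Bx /fr /= xr; apply: Bx => /=.
  have := ler_normB (x + h *: v) (h *: v); rewrite addrK => /le_trans; apply.
  apply: lerD => //.
  by rewrite normrZ ger0_norm// ler_piMl.
have fi (g : 'rV[R]_n -> R) C : measurable_fun setT g -> (forall x, `|g x| <= C) ->
    (forall x, ~ B x -> g x = 0) -> mu.-integrable setT (EFin \o g).
  move=> mg gC g0; rewrite (_ : EFin \o g = (EFin \o g) \_ B).
    apply/(integrable_mkcond _ _).1 => //.
    by apply: (@bounded_integrable_rV _ _ C) => //; exact: measurable_funS mg.
  by apply/funext => x; rewrite patchE; case: ifPn => // /negP xB; rewrite /= g0// => /mem_set.
have mf : measurable_fun setT f by exact: continuous_measurable_rV.
have mfv k : measurable_fun setT (fun x => f (x + k.+1%:R^-1 *: v)).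
  exact: (measurableT_comp mf (measurable_shift_rV _)).
have iff : mu.-integrable setT (EFin \o f) by exact: (fi _ M').
have ifv k : mu.-integrable setT (EFin \o fun x => f (x + k.+1%:R^-1 *: v)).
  by apply: (fi _ M') => // x Bx; apply/support_eq0/f0v.
have q0 k : (\int[mu]_x (q k x)%:E = 0)%E.
  under eq_integral do rewrite EFinM.
  have iB : mu.-integrable setT (fun x => (f (x + k.+1%:R^-1 *: v) - f x)%:E).
    exact: (integrableB measurableT (ifv k) iff).
  rewrite integralZl//.
  under eq_integral do rewrite EFinB.
  have mEf : measurable_fun setT (EFin \o f) by apply/measurable_EFinP.
  have := @integral_shift_rV _ _ (EFin \o f) _ mEf (ifv k) => /= shiftE.
  rewrite (integralB_EFin measurableT (ifv k) iff) shiftE.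
  by rewrite subee ?mule0// integrable_fin_num.
have qM k x : `|q k x| <= M * \1_B x.
  have [Bx|Bx] := pselect (B x); last first.
    rewrite /q indicE memNset//= mulr0 [f x]f0// subr0.
    by rewrite support_eq0 ?mulr0 ?normr0//; exact: f0v.
  rewrite indicE mem_set//= mulr1 /q.
  have /andP[h0 _] := h01 k.
  have [c _ ->] := @MVT_line f x v _ h0 df.
  by rewrite mulrC divfK.
have qdf x : q k x @[k --> \oo] --> 'D_v f x.
  have := cvg_comp _ _ cvg_harmonic_dnbhs (df x).
  apply: cvg_trans; apply: near_eq_cvg; near=> k.
  by rewrite /= /q invrK [x + _]addrC.
have iM : mu.-integrable setT (fun x => (M * \1_B x)%:E).
  apply: (fi _ M) => [|x|x Bx].
  - by apply: measurable_funM => //; exact: measurable_indic.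
  - by rewrite normrM ger0_norm// ler_piMr// indicE; case: (_ \in _); rewrite ?normr1 ?normr0.
  - by rewrite indicE memNset//= mulr0.
have qcvg : (\int[mu]_x (q k x)%:E)%E @[k --> \oo] --> (\int[mu]_x ('D_v f x)%:E)%E.
  apply: (@dominated_cvg _ _ _ mu setT measurableT (fun k x => (q k x)%:E)
    (fun x => ('D_v f x)%:E) (fun x => (M * \1_B x)%:E)).
  - move=> k; apply/measurable_EFinP.
    exact: (measurable_funM (measurable_cst _) (measurable_funB (mfv k) mf)).
  - by move=> x _; apply: cvg_EFin; [exact: nearW|exact: qdf].
  - by [].
  - exact: iM.
  - by move=> k x _; rewrite abse_EFin lee_fin.
have : (\int[mu]_x (q k x)%:E)%E @[k --> \oo] --> (0 : \bar R)%E.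
  by apply: cvg_near_cst; exact: nearW.
by move=> /(cvg_unique (@ereal_hausdorff R) qcvg).
Unshelve. all: by end_near. Qed.

End directional.

Section test_functions.
Context {R : realType} {n : nat}.
Implicit Types (f g : 'rV[R]_n -> R) (x : 'rV[R]_n).
Local Notation mu := (@lebesgue_rV R n).

Lemma smooth_continuous f : smooth f -> continuous f.
Proof. by move=> /(_ [::])[]. Qed.

Lemma smooth_derivable f x i : smooth f -> derivable f x (ebasis i).
Proof. by move=> /(_ [::])[_]. Qed.

Lemma smooth_continuous_derive f i : smooth f -> continuous ('D_(ebasis i) f).
Proof. by move=> /(_ [:: i])[]. Qed.

Lemma iter_partialDZ f g (c : R) s : smooth f -> smooth g ->
  iter_partial s (fun x => f x + c * g x) =
  (fun x => iter_partial s f x + c * iter_partial s g x).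
Proof.
move=> sf sg; elim: s => // i s /= ->; apply/funext => x.
have df := (sf s).2 i x; have dg := (sg s).2 i x.
have dcg : derivable (c \*: iter_partial s g) x (ebasis i) by exact: derivableZ.
by rewrite [LHS](deriveD df dcg) (deriveZ _ dg).
Qed.

Lemma smoothDZ f g (c : R) : smooth f -> smooth g ->
  smooth (fun x => f x + c * g x).
Proof.
move=> sf sg s; rewrite iter_partialDZ//; split.
  by move=> x; exact: cvgD ((sf s).1 x) (cvgM (cvg_cst c) ((sg s).1 x)).
move=> i x; have dcg : derivable (c \*: iter_partial s g) x (ebasis i).
  exact: derivableZ ((sg s).2 i x).
exact: derivableD ((sf s).2 i x) dcg.
Qed.

Lemma test_functionDZ D f g (c : R) : test_function D f -> test_function D g ->
  test_function D (fun x => f x + c * g x).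
Proof.
move=> [sf kf fD] [sg kg gD].
have sub : support (fun x => f x + c * g x) `<=` support f `|` support g.
  rewrite /Defs.support -closureU; apply: closureS => x /=.
  have [-> /=|/= f0 _] := eqVneq (f x) 0; last by left.
  by rewrite add0r mulf_eq0 negb_or => /andP[_ ?]; right.
split; first exact: smoothDZ.
- apply: (subclosed_compact _ (compactU kf kg) sub).
  exact: closed_closure.
- by move=> x /sub[/fD|/gD].
Qed.

Lemma gradientDZ f g (c : R) x : smooth f -> smooth g ->
  gradient (fun x => f x + c * g x) x = gradient f x + c *: gradient g x.
Proof.
move=> sf sg; apply/rowP => i; rewrite !mxE.
by have := iter_partialDZ c [:: i] sf sg => /(congr1 (@^~ x)).
Qed.

End test_functions.

(** * Euclidean norm *)

Lemma exprD_le {R : realDomainType} (a b : R) m : 0 <= a -> 0 <= b ->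
  (a + b) ^+ m <= 2 ^+ m * (a ^+ m + b ^+ m).
Proof.
move=> a0 b0.
wlog ab : a b a0 b0 / a <= b.
  by move=> H; have [|/ltW] := leP a b => /H; [|rewrite addrC (addrC (b ^+ m))]; apply.
apply: (@le_trans _ _ ((2 * b) ^+ m)).
  by apply: lerXn2r; rewrite ?nnegrE ?addr_ge0 ?mulr_ge0//; lra.
by rewrite exprMn ler_wpM2l ?exprn_ge0// lerDr exprn_ge0.
Qed.

(* The inequality is trivial when |w| <= eps |u|, and otherwise |u| < |w| / eps. *)
Lemma exprn_young_eps {R : realFieldType} (a b e : R) m : 0 <= a -> 0 <= b -> 0 < e ->
  a ^+ m * b <= e * a ^+ m.+1 + e ^- m * b ^+ m.+1.
Proof.
move=> a0 b0 e0; have [be|be] := leP b (e * a).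
  apply: (@le_trans _ _ (e * a ^+ m.+1)).
    rewrite (_ : e * _ = a ^+ m * (e * a)); last by rewrite exprS; ring.
    by rewrite ler_wpM2l// exprn_ge0.
  by rewrite lerDl mulr_ge0 ?invr_ge0 ?exprn_ge0// ltW.
apply: (@le_trans _ _ (e ^- m * b ^+ m.+1)).
  rewrite exprSr mulrA ler_wpM2r// -exprVn -exprMn.
  have aeb : a <= e^-1 * b by rewrite mulrC ler_pdivlMr// mulrC ltW.
  by apply: lerXn2r => //; rewrite nnegrE ?mulr_ge0 ?invr_ge0// ltW.
by rewrite lerDr mulr_ge0 ?exprn_ge0// ltW.
Qed.

(** The induction step multiplies by a and adds (a^(m+1) - b^(m+1)) (a - b) >= 0, true because both
    factors have the same sign. *)
Lemma exprn_amgm {R : realDomainType} (a b : R) m : 0 <= a -> 0 <= b ->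
  m.+1%:R * (a ^+ m * b) <= m%:R * a ^+ m.+1 + b ^+ m.+1.
Proof.
move=> a0 b0; elim: m => [|m IH]; first by rewrite expr0 !mul1r mul0r add0r.
have H : 0 <= (a ^+ m.+1 - b ^+ m.+1) * (a - b).
  have [ab|/ltW ba] := leP a b.
    by rewrite -mulrNN mulr_ge0// oppr_ge0 subr_le0//; apply: lerXn2r.
  by rewrite mulr_ge0// subr_ge0//; apply: lerXn2r.
have := ler_wpM2l a0 IH; rewrite -!natr1 !exprS in H * => IH'.
move: IH' H; set A := a ^+ m; set B := b ^+ m; set M := m%:R => IH' H.
nra.
Qed.

(** The graph of |t|^m lies above its tangent at a, of slope m |a|^(m-2) a; once expanded, this is
    [exprn_amgm] for |a| and |b|. *)
Lemma normr_convex {R : realDomainType} (a b : R) m : (2 <= m)%N ->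
  `|a| ^+ m + m%:R * (`|a| ^+ (m - 2) * (a * (b - a))) <= `|b| ^+ m.
Proof.
case: m => [|[|m]]// _; rewrite subSS subSS subn0.
rewrite mulrBr -expr2 -(real_normK (num_real a)).
have := exprn_amgm m.+1 (normr_ge0 a) (normr_ge0 b).
have : `|a| ^+ m * (a * b) <= `|a| ^+ m * (`|a| * `|b|).
  by rewrite ler_wpM2l ?exprn_ge0// -normrM ler_norm.
have : 0 <= m%:R :> R by [].
rewrite -!natr1 !exprS expr0; move: (a * b) `|a| `|b| => d a' b'.
move: (a' ^+ m) (b' ^+ m) m%:R => E B M.
nra.
Qed.

Section euclidean_norm.
Context {R : realType} {n : nat}.
Implicit Types (v w : 'rV[R]_n).

Lemma dotpC v w : dotp v w = dotp w v.
Proof. by apply: eq_bigr => i _; rewrite mulrC. Qed.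

Lemma dotpDl v w z : dotp (v + w) z = dotp v z + dotp w z.
Proof. by rewrite /dotp -big_split; apply: eq_bigr => i _ /=; rewrite mxE mulrDl. Qed.

Lemma dotpZl c v w : dotp (c *: v) w = c * dotp v w.
Proof. by rewrite /dotp big_distrr; apply: eq_bigr => i _ /=; rewrite mxE mulrA. Qed.

Lemma dotpDr v w z : dotp z (v + w) = dotp z v + dotp z w.
Proof. by rewrite !(dotpC z) dotpDl. Qed.

Lemma dotpZr c v w : dotp w (c *: v) = c * dotp w v.
Proof. by rewrite !(dotpC w) dotpZl. Qed.

Lemma dotp_ge0 v : 0 <= dotp v v.
Proof. by apply: sumr_ge0 => i _; rewrite -expr2 sqr_ge0. Qed.

Lemma enorm_ge0 v : 0 <= enorm v. Proof. exact: sqrtr_ge0. Qed.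

Lemma enorm_sqr v : enorm v ^+ 2 = dotp v v.
Proof. exact/sqr_sqrtr/dotp_ge0. Qed.

Lemma enorm_coord v i : `|v 0 i| <= enorm v.
Proof.
rewrite -sqrtr_sqr /enorm ler_sqrt ?dotp_ge0// /dotp (bigD1 i)//= -expr2 lerDl.
by apply: sumr_ge0 => j _; rewrite -expr2 sqr_ge0.
Qed.

Lemma enorm_eq0 v : enorm v = 0 -> v = 0.
Proof.
move=> v0; apply/rowP => i; rewrite mxE; apply/eqP.
by rewrite -normr_le0 -v0 enorm_coord.
Qed.

Lemma enorm0 : enorm (0 : 'rV[R]_n) = 0.
Proof. by rewrite /enorm /dotp big1 ?sqrtr0// => i _; rewrite mxE mul0r. Qed.

Lemma enormZ c v : enorm (c *: v) = `|c| * enorm v.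
Proof. by rewrite /enorm dotpZl dotpZr mulrA -expr2 sqrtrM ?sqr_ge0// sqrtr_sqr. Qed.

Lemma normr_dotp_le v w : `|dotp v w| <= enorm v * enorm w.
Proof.
rewrite -sqrtr_sqr /enorm -sqrtrM ?dotp_ge0// ler_sqrt; last first.
  by rewrite mulr_ge0// dotp_ge0.
have := dotp_ge0 w; rewrite le_eqVlt => /predU1P[w0|w0].
  have -> : w = 0 by apply: enorm_eq0; rewrite /enorm -w0 sqrtr0.
  by rewrite -(scale0r 0) !dotpZr !mul0r mulr0 expr0n.
(* The square of this vector is |w|^2 times the difference |v|^2 |w|^2 - (v.w)^2. *)
have := dotp_ge0 (dotp w w *: v - dotp v w *: w).
rewrite -scaleNr !(dotpDl, dotpDr, dotpZl, dotpZr) (dotpC w v).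
set a := dotp w w in w0 *; set b := dotp v w; set c := dotp v v => H.
rewrite -subr_ge0 -(pmulr_rge0 _ w0).
by apply: le_trans H _; rewrite le_eqVlt; apply/orP; left; apply/eqP; ring.
Qed.

Lemma enormD_le v w : enorm (v + w) <= enorm v + enorm w.
Proof.
rewrite -(@ler_pXn2r _ 2)// ?nnegrE ?addr_ge0 ?enorm_ge0//.
rewrite sqrrD !enorm_sqr !(dotpDl, dotpDr) (dotpC w v).
have := le_trans (ler_norm _) (normr_dotp_le v w); lra.
Qed.

Lemma enormD_le_exp v w m :
  enorm (v + w) ^+ m <= 2 ^+ m * (enorm v ^+ m + enorm w ^+ m).
Proof.
apply: le_trans (exprD_le _ (enorm_ge0 v) (enorm_ge0 w)).
by apply: lerXn2r; rewrite ?nnegrE ?addr_ge0 ?enorm_ge0// enormD_le.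
Qed.

(** The vector form of [normr_convex]; Cauchy-Schwarz reduces it to the same inequality between the
    two norms. *)
Lemma enorm_convex v w m : (2 <= m)%N ->
  enorm v ^+ m + m%:R * (enorm v ^+ (m - 2) * dotp v (w - v)) <= enorm w ^+ m.
Proof.
case: m => [|[|m]]// _; rewrite subSS subSS subn0.
rewrite dotpDr -scaleN1r dotpZr mulN1r -enorm_sqr.
have := exprn_amgm m.+1 (enorm_ge0 v) (enorm_ge0 w).
have : enorm v ^+ m * dotp v w <= enorm v ^+ m * (enorm v * enorm w).
  rewrite ler_wpM2l ?exprn_ge0 ?enorm_ge0//.
  exact: le_trans (ler_norm _) (normr_dotp_le v w).
have : 0 <= m%:R :> R by [].
rewrite -!natr1 !exprS expr0; move: (enorm v) (enorm w) => a b.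
move: (dotp v w) (a ^+ m) (b ^+ m) m%:R => d A B M.
nra.
Qed.

Lemma continuous_enorm_comp (T : topologicalType) (F : T -> 'rV[R]_n) :
  (forall i, continuous (fun x => F x 0 i)) -> continuous (fun x => enorm (F x)).
Proof.
move=> cF x; apply: (@continuous_comp _ _ _ (fun x => dotp (F x) (F x)) Num.sqrt).
  apply: cvg_big; first exact: add_continuous.
  by move=> i _; exact: cvgM (cF i x) (cF i x).
exact: sqrt_continuous.
Qed.

Lemma measurable_dotp d (T : measurableType d) (D : set T) (F G : T -> 'rV[R]_n) :
  (forall i, measurable_fun D (fun x => F x 0 i)) ->
  (forall i, measurable_fun D (fun x => G x 0 i)) ->
  measurable_fun D (fun x => dotp (F x) (G x)).
Proof.
move=> mF mG; rewrite /dotp; apply: measurable_sum => i.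
exact: measurable_funM.
Qed.

Lemma measurable_enorm d (T : measurableType d) (D : set T) (F : T -> 'rV[R]_n) :
  (forall i, measurable_fun D (fun x => F x 0 i)) ->
  measurable_fun D (fun x => enorm (F x)).
Proof.
move=> mF.
exact: (measurableT_comp (continuous_measurable_fun (@sqrt_continuous R)) (measurable_dotp mF mF)).
Qed.

End euclidean_norm.

(** * Sobolev functions *)

Section sobolev_theory.
Context {R : realType} {n : nat} (D : set 'rV[R]_n).
Hypotheses (openD : open D) (boundedD : bounded_set D).
Local Notation mu := (@lebesgue_rV R n).
Implicit Types (u f : 'rV[R]_n -> R) (du : 'rV[R]_n -> 'rV[R]_n).

Let mD : measurable D := open_measurable_rV openD.
Let Doo : (mu D < +oo)%E := bounded_lebesgue_rV_lty boundedD.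

Lemma gradientE f i x : gradient f x 0 i = 'D_(ebasis i) f x.
Proof. by rewrite mxE. Qed.

Lemma test_function_bounded f : test_function D f ->
  exists2 M, 0 <= M & forall x, `|f x| <= M.
Proof.
move=> [sf kf _]; apply: (continuous_support_bounded (smooth_continuous sf) kf).
exact: support_eq0.
Qed.

Lemma continuous_enorm_gradient f : smooth f ->
  continuous (fun x => enorm (gradient f x)).
Proof.
move=> sf; apply: continuous_enorm_comp => i.
under eq_fun do rewrite gradientE.
exact: smooth_continuous_derive.
Qed.

Lemma gradient_support_eq0 f x : ~ support f x -> gradient f x = 0.
Proof. by move=> sfx; apply/rowP => i; rewrite !mxE derive_support_eq0. Qed.

Lemma test_function_gradient_bounded f : test_function D f ->
  exists2 M, 0 <= M & forall x, enorm (gradient f x) <= M.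
Proof.
move=> [sf kf _].
have [|M M0 fM] := continuous_support_bounded (continuous_enorm_gradient sf) kf.
  by move=> x /gradient_support_eq0 ->; exact: enorm0.
by exists M => // x; rewrite -[leLHS]ger0_norm// enorm_ge0.
Qed.

Lemma measurable_test_function f : test_function D f -> measurable_fun D f.
Proof. by move=> [sf _ _]; exact/continuous_measurable_rV/smooth_continuous. Qed.

Lemma measurable_gradient f i : test_function D f ->
  measurable_fun D (fun x => gradient f x 0 i).
Proof.
move=> [sf _ _]; under eq_fun do rewrite gradientE.
exact/continuous_measurable_rV/smooth_continuous_derive.
Qed.

Lemma integrable_bounded_mul (f g : 'rV[R]_n -> R) M : measurable_fun D g ->
  (forall x, D x -> `|g x| <= M) -> mu.-integrable D (EFin \o f) ->
  mu.-integrable D (EFin \o (fun x => f x * g x)).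
Proof.
move=> mg gM fi; have mf : measurable_fun D f by apply/measurable_EFinP; case/integrableP : fi.
apply: (@le_integrable _ _ _ _ _ mD _ (fun x => (M * f x)%:E)).
- by apply/measurable_EFinP; exact: measurable_funM.
- move=> x Dx; rewrite !abse_EFin lee_fin !normrM mulrC ler_wpM2r//.
  by rewrite (le_trans (gM _ Dx))// ler_norm.
- exact: (integrableZl mD M fi).
Qed.

Lemma integrable_test_function f : test_function D f -> mu.-integrable D (EFin \o f).
Proof.
move=> tf; have [M _ fM] := test_function_bounded tf.
apply: (bounded_integrable_rV mD Doo (measurable_test_function tf)) => x _.
exact: fM.
Qed.

Lemma derive_test_function_bounded f i : test_function D f ->
  exists M, forall x, `|'D_(ebasis i) f x| <= M.
Proof.
move=> /test_function_gradient_bounded[M _ fM]; exists M => x.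
by rewrite -gradientE (le_trans (enorm_coord _ _)).
Qed.

Lemma measurable_derive_test_function f i : test_function D f ->
  measurable_fun D ('D_(ebasis i) f).
Proof.
by move=> [sf _ _]; exact/continuous_measurable_rV/smooth_continuous_derive.
Qed.

(** The product f psi has compact support inside D. The integral of its partial derivative over the
    whole space is 0, and it is also the integral over D because the derivative vanishes off D; the
    product rule then splits it. *)
Lemma weak_gradient_test f : test_function D f -> weak_gradient D f (gradient f).
Proof.
move=> tf psi tpsi i; have [sf kf fD] := tf; have [spsi kpsi psiD] := tpsi.
have dM x : 'D_(ebasis i) (f * psi) x =
    f x * 'D_(ebasis i) psi x + psi x * 'D_(ebasis i) f x.
  by rewrite deriveM//; exact: smooth_derivable.
have sub : support (f * psi) `<=` support f.
  apply: closureS => x /=; rewrite -[(f * psi) x]/(f x * psi x).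
  by rewrite mulf_eq0 negb_or => /andP[].
have i1 : mu.-integrable D (EFin \o (fun x => f x * 'D_(ebasis i) psi x)).
  have [M psiM] := derive_test_function_bounded i tpsi.
  exact: (integrable_bounded_mul (measurable_derive_test_function i tpsi)
    (fun x _ => psiM x) (integrable_test_function tf)).
have i2 : mu.-integrable D (EFin \o (fun x => psi x * 'D_(ebasis i) f x)).
  have [M fM] := derive_test_function_bounded i tf.
  exact: (integrable_bounded_mul (measurable_derive_test_function i tf)
    (fun x _ => fM x) (integrable_test_function tpsi)).
have : (\int[mu]_x ('D_(ebasis i) (f * psi) x)%:E = 0)%E.
  apply: integral_derive_eq0.
  - by move=> x; apply: continuousM; exact: smooth_continuous.
  - by move=> x; apply: derivableM; exact: smooth_derivable.
  - rewrite (_ : 'D_(ebasis i) _ = fun x =>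
      f x * 'D_(ebasis i) psi x + psi x * 'D_(ebasis i) f x); last exact/funext.
    move=> x; have cM (g h : 'rV[R]_n -> R) : continuous g -> continuous h ->
        {for x, continuous (fun y => g y * h y)} by move=> cg ch; exact: cvgM (cg x) (ch x).
    exact: cvgD (cM _ _ (smooth_continuous sf) (@smooth_continuous_derive _ _ _ i spsi))
      (cM _ _ (smooth_continuous spsi) (@smooth_continuous_derive _ _ _ i sf)).
  - by apply: (subclosed_compact _ kf sub); exact: closed_closure.
rewrite (_ : (fun x => _) = (fun x => ('D_(ebasis i) (f * psi) x)%:E) \_ D).
  rewrite -integral_mkcond; under eq_integral do rewrite dM.
  rewrite (integralD_EFin mD i1 i2) => i0; apply/eqP; rewrite -addr_eq0; apply/eqP.
  under [X in _ + X]eq_Rintegral do rewrite gradientE mulrC.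
  by rewrite /Rintegral -fineD ?i0//; exact: integrable_fin_num.
apply/funext => x; rewrite patchE; case: ifPn => // /negP xD.
rewrite derive_support_eq0// => /sub /fD Dx; apply: xD; exact: mem_set.
Qed.

Lemma integral_exprn_lty f M m : measurable_fun D f -> (forall x, `|f x| <= M) ->
  (\int[mu]_(x in D) (`|f x| ^+ m)%:E < +oo)%E.
Proof.
move=> mf fM.
have : mu.-integrable D (EFin \o (fun x => `|f x| ^+ m)).
  apply: (@bounded_integrable_rV _ _ _ _ (M ^+ m)) => // [|x _].
    by apply: measurable_funX; exact: measurableT_comp.
  rewrite ger0_norm ?exprn_ge0//; apply: lerXn2r; rewrite ?nnegrE//.
  exact: le_trans (fM x).
by move=> /integrableP[_]; under eq_integral do rewrite /= ger0_norm ?exprn_ge0//.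
Qed.

End sobolev_theory.

Lemma addrBD2r (V : zmodType) (a b c : V) : (a + c) - (b + c) = a - b.
Proof. by rewrite opprD addrACA subrr addr0. Qed.

(** * Integrals of real-valued functions *)

Section real_integrable.
Context d (T : measurableType d) (R : realType) (mu : {measure set T -> \bar R}).
Context (D : set T) (mD : measurable D).
Implicit Types f g : T -> R.

Lemma le_integrable_real f g : measurable_fun D f ->
  (forall x, D x -> `|f x| <= g x) -> mu.-integrable D (EFin \o g) ->
  mu.-integrable D (EFin \o f).
Proof.
move=> mf fg; apply: le_integrable; [exact: mD|exact/measurable_EFinP|].
by move=> x Dx; rewrite !abse_EFin lee_fin (le_trans (fg _ Dx))// ler_norm.
Qed.

Lemma ge0_integrable_lty f : measurable_fun D f -> (forall x, D x -> 0 <= f x) ->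
  mu.-integrable D (EFin \o f) <-> (\int[mu]_(x in D) (f x)%:E < +oo)%E.
Proof.
move=> mf f0.
have E : (\int[mu]_(x in D) `|(EFin \o f) x| = \int[mu]_(x in D) (f x)%:E)%E.
  by apply: eq_integral => x /set_mem Dx; rewrite abse_EFin ger0_norm// f0.
split=> [/integrableP[_]|foo]; first by rewrite E.
by apply/integrableP; split; [exact/measurable_EFinP|rewrite E].
Qed.

Lemma EFin_Rintegral f : mu.-integrable D (EFin \o f) ->
  ((\int[mu]_(x in D) f x)%:E = \int[mu]_(x in D) (f x)%:E)%E.
Proof. by move=> fi; rewrite /Rintegral fineK// integrable_fin_num. Qed.

(** Integrands below are brought to the single shape [f + c * g] of this lemma and of [RintegralDZ],
    which explains their summands [0 +] and their factors [1 *] and [-1 *]. *)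
Lemma integrable_realDZ f g (c : R) : mu.-integrable D (EFin \o f) ->
  mu.-integrable D (EFin \o g) ->
  mu.-integrable D (EFin \o (fun x => f x + c * g x)).
Proof. move=> fi gi; exact: (integrableD mD fi (integrableZl mD c gi)). Qed.

Lemma RintegralDZ f g (c : R) : mu.-integrable D (EFin \o f) ->
  mu.-integrable D (EFin \o g) ->
  \int[mu]_(x in D) (f x + c * g x) =
  \int[mu]_(x in D) f x + c * \int[mu]_(x in D) g x.
Proof.
move=> fi gi; rewrite (RintegralD mD fi (integrableZl mD c gi)).
by rewrite (RintegralZl c mD gi).
Qed.

End real_integrable.

(** * Sobolev functions combined with test functions *)

Section sobolev_combination.
Context {R : realType} {n : nat} (D : set 'rV[R]_n).
Hypotheses (n_gt0 : (0 < n)%N) (openD : open D) (boundedD : bounded_set D).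
Local Notation mu := (@lebesgue_rV R n).
Implicit Types (u f : 'rV[R]_n -> R) (du : 'rV[R]_n -> 'rV[R]_n).

Let mD : measurable D := open_measurable_rV openD.
Let Doo : (mu D < +oo)%E := bounded_lebesgue_rV_lty boundedD.

Lemma integrable_cst_rV (c : R) : mu.-integrable D (EFin \o (cst c)).
Proof. by apply: (@bounded_integrable_rV _ _ _ _ `|c|). Qed.

Lemma W1n_integrable_exprn u du : W1n D u du ->
  mu.-integrable D (EFin \o (fun x => `|u x| ^+ n)).
Proof.
move=> [mu_ _ ui _ _].
apply: (@ge0_integrable_lty _ _ _ mu D (fun x => `|u x| ^+ n) _ _).2 ui.
  exact: (measurable_funX _ (measurableT_comp (@normr_measurable _ _) mu_)).
by move=> x _; rewrite exprn_ge0.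
Qed.

Lemma W1n_integrable_gradient u du : W1n D u du ->
  mu.-integrable D (EFin \o (fun x => enorm (du x) ^+ n)).
Proof.
move=> [_ mdu _ ui _].
apply: (@ge0_integrable_lty _ _ _ mu D (fun x => enorm (du x) ^+ n) _ _).2 ui.
  exact: (measurable_funX _ (measurable_enorm mdu)).
by move=> x _; rewrite exprn_ge0// enorm_ge0.
Qed.

(** On a set of finite measure L^n is contained in L^1, because g <= 1 + g^n. The products in the
    definition of the weak gradient become integrable in this way. *)
Lemma exprn_integrable f g : measurable_fun D f -> (forall x, `|f x| <= g x) ->
  mu.-integrable D (EFin \o (fun x => g x ^+ n)) -> mu.-integrable D (EFin \o f).
Proof.
move=> mf fg gi; apply: (@le_integrable_real _ _ _ _ _ mD _ (fun x => 1 + 1 * g x ^+ n)) => //.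
  move=> x _; have g0 := le_trans (normr_ge0 _) (fg x).
  rewrite mul1r; have [g1|/ltW g1] := leP (g x) 1.
    by rewrite (le_trans (fg x))// (le_trans g1)// lerDl exprn_ge0.
  by rewrite (le_trans (fg x))// ler_wpDl// -[leLHS]expr1 ler_weXn2l.
exact: (integrable_realDZ mD 1 (integrable_cst_rV 1) gi).
Qed.

Lemma row_combinationE (v w : 'rV[R]_n) c i : (v + c *: w) 0 i = v 0 i + c * w 0 i.
Proof. by rewrite !mxE. Qed.

Lemma W1n_test_function f : test_function D f -> W1n D f (gradient f).
Proof.
move=> tf; split.
- exact: measurable_test_function.
- by move=> i; exact: measurable_gradient.
- have [M _ fM] := test_function_bounded tf.
  exact: (integral_exprn_lty openD boundedD _ (measurable_test_function tf) fM).
- have [M M0 fM] := test_function_gradient_bounded tf.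
  have H := @integral_exprn_lty _ _ D openD boundedD (fun x => enorm (gradient f x)) M n.
  under eq_integral do rewrite -[enorm _]ger0_norm ?enorm_ge0//.
  apply: H; last by move=> x; rewrite ger0_norm ?enorm_ge0.
  by apply: measurable_enorm => i; exact: measurable_gradient.
- exact: weak_gradient_test.
Qed.

Lemma W1n_combination u du f (c : R) : W1n D u du -> test_function D f ->
  W1n D (fun x => u x + c * f x) (fun x => du x + c *: gradient f x).
Proof.
move=> Wu tf; have Wf := W1n_test_function tf.
have [mu_ mdu _ _ gu] := Wu; have [mf mdf _ _ gf] := Wf.
have mDZ (g h : 'rV[R]_n -> R) : measurable_fun D g -> measurable_fun D h ->
    measurable_fun D (fun x => g x + c * h x).
  by move=> mg mh; exact: (measurable_funD mg (measurable_funM (measurable_cst c) mh)).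
have muf := mDZ _ _ mu_ mf.
have mduf i : measurable_fun D (fun x => (du x + c *: gradient f x) 0 i).
  under eq_fun do rewrite row_combinationE.
  exact: mDZ.
split => //.
- apply: (@ge0_integrable_lty _ _ _ mu D (fun x => `|u x + c * f x| ^+ n) _ _).1.
  + exact: (measurable_funX _ (measurableT_comp (@normr_measurable _ _) muf)).
  + by move=> x _; rewrite exprn_ge0.
  apply: (@le_integrable_real _ _ _ _ _ mD _
    (fun x => 0 + 2 ^+ n * (`|u x| ^+ n + `|c| ^+ n * `|f x| ^+ n))).
  + exact: (measurable_funX _ (measurableT_comp (@normr_measurable _ _) muf)).
  + move=> x _; rewrite add0r ger0_norm ?exprn_ge0// -exprMn -normrM.
    apply: le_trans (exprD_le _ (normr_ge0 _) (normr_ge0 _)).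
    by apply: lerXn2r; rewrite ?nnegrE ?addr_ge0// ler_normD.
  apply: (integrable_realDZ mD _ (integrable_cst_rV 0)).
  exact: (integrable_realDZ mD _ (W1n_integrable_exprn Wu) (W1n_integrable_exprn Wf)).
- apply: (@ge0_integrable_lty _ _ _ mu D (fun x => enorm (du x + c *: gradient f x) ^+ n) _ _).1.
  + exact: (measurable_funX _ (measurable_enorm mduf)).
  + by move=> x _; rewrite exprn_ge0// enorm_ge0.
  apply: (@le_integrable_real _ _ _ _ _ mD _
    (fun x => 0 + 2 ^+ n * (enorm (du x) ^+ n + `|c| ^+ n * enorm (gradient f x) ^+ n))).
  + exact: (measurable_funX _ (measurable_enorm mduf)).
  + move=> x _; rewrite add0r ger0_norm ?exprn_ge0 ?enorm_ge0// -exprMn -enormZ.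
    exact: enormD_le_exp.
  apply: (integrable_realDZ mD _ (integrable_cst_rV 0)).
  exact: (integrable_realDZ mD _ (W1n_integrable_gradient Wu) (W1n_integrable_gradient Wf)).
- move=> psi tpsi i.
  have iu : mu.-integrable D (EFin \o u).
    exact: (exprn_integrable mu_ (fun x => lexx _) (W1n_integrable_exprn Wu)).
  have idu : mu.-integrable D (EFin \o (fun x => du x 0 i)).
    exact: (exprn_integrable (mdu i) (fun x => enorm_coord _ i) (W1n_integrable_gradient Wu)).
  have idf : mu.-integrable D (EFin \o (fun x => gradient f x 0 i)).
    exact: (exprn_integrable (mdf i) (fun x => enorm_coord _ i) (W1n_integrable_gradient Wf)).
  have ife := integrable_test_function openD boundedD tf.
  have [M psiM] := derive_test_function_bounded i tpsi.
  have [M' _ psiM'] := test_function_bounded tpsi.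
  have mpsi := measurable_test_function tpsi.
  have mdpsi := measurable_derive_test_function i tpsi.
  transitivity (\int[mu]_(x in D) (u x * 'D_(ebasis i) psi x + c * (f x * 'D_(ebasis i) psi x))).
    by apply: eq_Rintegral => x _; rewrite mulrDl mulrA.
  rewrite (RintegralDZ mD c (integrable_bounded_mul openD mdpsi (fun x _ => psiM x) iu)
    (integrable_bounded_mul openD mdpsi (fun x _ => psiM x) ife)) gu// gf//.
  rewrite mulrN -opprD; congr (- _).
  rewrite -(RintegralDZ mD c (integrable_bounded_mul openD mpsi (fun x _ => psiM' x) idu)
    (integrable_bounded_mul openD mpsi (fun x _ => psiM' x) idf)).
  by apply: eq_Rintegral => x _; rewrite row_combinationE mulrDl mulrA.
Qed.

(** Adding [c * f] to every member of the approximating sequence leaves the differences unchanged.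
    Both the remainders u - f and the variations u + c psi thereby come under the inequality
    defining K. *)
Lemma W1n0_combination u du f (c : R) : W1n0 D u du -> test_function D f ->
  W1n0 D (fun x => u x + c * f x) (fun x => du x + c *: gradient f x).
Proof.
move=> [Wu [phi [tphi phiu dphiu]]] tf; split; first exact: W1n_combination.
exists (fun k x => phi k x + c * f x); split => [k||].
- exact: test_functionDZ.
- by under eq_fun do under eq_integral do rewrite addrBD2r.
- under eq_fun => k.
    under eq_integral.
      move=> x _; have [sphi _ _] := tphi k; have [sf _ _] := tf.
      rewrite gradientDZ// addrBD2r; over.
    over.
  by [].
Qed.

Lemma W1n0_test_function f : test_function D f -> W1n0 D f (gradient f).
Proof.
move=> tf; split; first exact: W1n_test_function.
exists (fun=> f); split => //.
- under eq_fun do under eq_integral do rewrite subrr normr0 expr0n gtn_eqF//.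
  by under eq_fun do rewrite integral0; exact: cvg_cst.
- under eq_fun do under eq_integral do rewrite subrr enorm0 expr0n gtn_eqF//.
  by under eq_fun do rewrite integral0; exact: cvg_cst.
Qed.

Lemma W1n0_approx u du (e : R) : W1n0 D u du -> 0 < e ->
  exists f, [/\ test_function D f,
    \int[mu]_(x in D) `|u x + -1 * f x| ^+ n <= e &
    \int[mu]_(x in D) enorm (du x + -1 *: gradient f x) ^+ n <= e].
Proof.
move=> [Wu [phi [tphi phiu dphiu]]] e0.
have [k [k1 k2]] : exists k,
    (\int[mu]_(x in D) (`|phi k x - u x| ^+ n)%:E <= e%:E)%E /\
    (\int[mu]_(x in D) (enorm (gradient (phi k) x - du x) ^+ n)%:E <= e%:E)%E.
  have H (a : nat -> \bar R) : a k @[k --> \oo] --> 0%E -> \forall k \near \oo, (a k <= e%:E)%E.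
    move=> a0; have /a0 : nbhs 0%E [set y : \bar R | (y < e%:E)%E].
      by apply: open_nbhs_nbhs; split; [exact: open_ereal_lt_ereal|rewrite /= lte_fin].
    by apply: (@filterS _ \oo _ [set m | (a m < e%:E)%E]) => m; exact: ltW.
  near \oo => k; exists k; split; near: k; exact: H.
have W := W1n_combination (-1) Wu (tphi k).
exists (phi k); split => //; rewrite -lee_fin.
- rewrite (EFin_Rintegral mD (W1n_integrable_exprn W)).
  apply: le_trans k1; rewrite le_eqVlt; apply/orP; left; apply/eqP.
  by apply: eq_integral => x _; rewrite mulN1r distrC.
- rewrite (EFin_Rintegral mD (W1n_integrable_gradient W)).
  apply: le_trans k2; rewrite le_eqVlt; apply/orP; left; apply/eqP.
  apply: eq_integral => x _; rewrite scaleN1r -opprB -scaleN1r enormZ.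
  by rewrite normrN normr1 mul1r.
Unshelve. all: by end_near. Qed.

End sobolev_combination.

(** * Consequences of the Moser-Trudinger bound *)

Section moser_trudinger_consequences.
Context {R : realType} {n : nat} (D : set 'rV[R]_n) (alpha K : R).
Hypotheses (n_ge2 : (2 <= n)%N) (openD : open D) (boundedD : bounded_set D).
Hypotheses (alpha_gt0 : 0 < alpha) (K_optimal : optimal_constant alpha D K).
Local Notation mu := (@lebesgue_rV R n).
Implicit Types (u f : 'rV[R]_n -> R) (du : 'rV[R]_n -> 'rV[R]_n).

Let n_gt0 : (0 < n)%N. Proof. exact: ltn_trans n_ge2. Qed.
Let mD : measurable D := open_measurable_rV openD.
Let Doo : (mu D < +oo)%E := bounded_lebesgue_rV_lty boundedD.

Definition energy du : R := \int[mu]_(x in D) enorm (du x) ^+ n.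

Lemma energy_ge0 du : 0 <= energy du.
Proof. by apply: Rintegral_ge0 => x _; rewrite exprn_ge0// enorm_ge0. Qed.

Lemma grad_norm_exprn du : grad_norm D du ^+ n = energy du.
Proof.
rewrite /grad_norm -/(energy du) -powR_mulrn ?powR_ge0// -powRrM mulVf.
  by rewrite powRr1// energy_ge0.
by rewrite pnatr_eq0 -lt0n.
Qed.

Lemma exists_nontrivial : exists u du, W1n0 D u du /\ nontrivial D u.
Proof.
apply: contrapT => H; have [_ Kmin] := K_optimal.
suff /Kmin : moser_trudinger_bound alpha D (K - 1) by lra.
by move=> u du Wu nu; exfalso; apply: H; exists u, du.
Qed.

Lemma trivial_integral0 u : measurable_fun D u ->
  mu.-integrable D (EFin \o (fun x => `|u x| ^+ n)) ->
  \int[mu]_(x in D) `|u x| ^+ n <= 0 -> ~ nontrivial D u.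
Proof.
move=> mu_ iu u0; apply.
pose g x := `|u x| ^+ n.
have mg : measurable_fun D (EFin \o g) by case/integrableP : iu.
have /(ae_eq_integral_abs _ mD mg).1 : (\int[mu]_(x in D) `|(EFin \o g) x| = 0)%E.
  apply/eqP; rewrite eq_le integral_ge0// andbT.
  under eq_integral do rewrite /= ger0_norm ?exprn_ge0//.
  by rewrite -(EFin_Rintegral mD iu) lee_fin.
apply: filterS => x + Dx => /(_ Dx) /= [] /eqP.
by rewrite expf_eq0 normr_eq0 => /andP[_ /eqP].
Qed.

(** Were the whole space null, every function would vanish almost everywhere, against
    [exists_nontrivial]. *)
Lemma lebesgue_rV_setT_neq0 : mu setT != 0%E.
Proof.
apply/eqP => muT0; have [u [du [_]]] := exists_nontrivial; apply.
exists setT; split => //.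
Qed.

Lemma integral_gt0_rV f x : continuous f -> (forall y, D y -> 0 <= f y) ->
  D x -> 0 < f x -> (0 < \int[mu]_(y in D) (f y)%:E)%E.
Proof.
move=> cf f0 Dx fx; pose U := D `&` f @^-1` `]f x / 2, +oo[.
have oU : open U.
  apply: openI => //; apply: open_comp; last exact: interval_open.
  by move=> y _; exact: cf.
have muU : (0 < mu U)%E.
  apply: lebesgue_rV_open_gt0 => //; first exact: lebesgue_rV_setT_neq0.
  by exists x; split => //=; rewrite in_itv/= andbT; lra.
have mf : measurable_fun D (EFin \o f) by apply/measurable_EFinP; exact: continuous_measurable_rV.
have f2 : 0 < f x / 2 by rewrite divr_gt0.
apply: (@lt_le_trans _ _ (\int[mu]_(y in U) (f x / 2)%:E)%E).
  rewrite integral_cst; last exact: open_measurable_rV.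
  by rewrite mule_gt0 ?lte_fin.
apply: (@le_trans _ _ (\int[mu]_(y in U) (f y)%:E)%E).
  apply: ge0_le_integral => //.
  - exact: open_measurable_rV.
  - by move=> y _; rewrite lee_fin ltW.
  - by apply: measurable_funS mf => // y [].
  - by move=> y [_ /=]; rewrite in_itv/= andbT lee_fin => /ltW.
apply: ge0_subset_integral => //; last by move=> y [].
exact: open_measurable_rV.
Qed.

(** If all test functions vanished on D, so would the approximations of a nontrivial u, and the L^n
    norm of u would be 0. A continuous function is wanted here, as positivity at one point then
    spreads to an open set. *)
Lemma exists_test_function : exists f x, [/\ test_function D f, D x & f x != 0].
Proof.
have [u [du [Wu nu]]] := exists_nontrivial; apply: contrapT => H.
have [WWu _] := Wu; have [mu_ _ _ _ _] := WWu.
apply: (trivial_integral0 mu_ (W1n_integrable_exprn WWu)) nu.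
apply/ler_addgt0Pl => e e0; rewrite addr0.
have [f [tf fu _]] := W1n0_approx n_gt0 openD boundedD Wu e0.
apply: le_trans fu; rewrite le_eqVlt; apply/orP; left; apply/eqP.
apply: eq_Rintegral => x /set_mem Dx.
suff -> : f x = 0 by rewrite mulr0 addr0.
by apply: contrapT => /eqP fx; apply: H; exists f, x.
Qed.

(** Along a coordinate direction f passes from a nonzero value to 0, so a partial derivative is
    nonzero somewhere on the segment, and by continuity the energy density is positive on an open
    set. *)
Lemma energy_test_gt0 f x : test_function D f -> f x != 0 -> 0 < energy (gradient f).
Proof.
move=> tf fx; have [sf kf fD] := tf.
have [i _] : exists i : 'I_n, true by exists (Ordinal n_gt0).
have [r [_ /(_ (`|r| + 1))]] := compact_bounded kf.
rewrite (le_lt_trans (ler_norm _)) ?ltrDl// => /(_ isT) fr.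
(* With this t the i-th coordinate of x + t v is at least |r| + 2, beyond the bound |r| + 1 for the
   support. *)
pose v := ebasis i : 'rV[R]_n; pose t := `|r| + 2 + `|x|.
have t0 : 0 <= t by rewrite !addr_ge0.
have fxt : f (x + t *: v) = 0.
  apply: support_eq0 => /fr /= xt.
  have := le_trans (ler_coord_norm _ i) xt; rewrite !mxE !eqxx mulr1 => H.
  have H1 := ler_coord_norm x i.
  have := ler_normD (x 0 i + t) (- x 0 i); rewrite normrN addrAC subrr add0r (ger0_norm t0) /t.
  lra.
have [c _ E] := MVT_line x t0 (fun y => @smooth_derivable _ _ f y i sf).
have dfx : 'D_(ebasis i) f (x + c *: v) != 0.
  apply: contraNneq fx => d0; rewrite d0 mul0r fxt sub0r in E; apply/eqP/oppr_inj.
  by rewrite E oppr0.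
have idf := W1n_integrable_gradient (W1n_test_function openD boundedD tf).
rewrite -lte_fin (EFin_Rintegral mD idf).
apply: (@integral_gt0_rV _ (x + c *: v)).
- move=> y; apply: (@continuous_comp _ _ _ (fun x => enorm (gradient f x))
    (fun z : R => z ^+ n)); last exact: exprn_continuous.
  exact: continuous_enorm_gradient.
- by move=> y _; rewrite exprn_ge0// enorm_ge0.
- by apply: fD; apply: contrapT => /derive_support_eq0 d0; rewrite d0 eqxx in dfx.
- rewrite exprn_gt0// lt_neqAle enorm_ge0 andbT eq_sym.
  apply: contra_neq dfx => /enorm_eq0 g0.
  by rewrite -gradientE g0 mxE.
Qed.

Lemma continuous_fM_exprn (c : R) : continuous (fun z : R => fM n alpha (c * `|z| ^+ n)).
Proof.
have cX : continuous (fun z : R => c * `|z| ^+ n).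
  move=> z; apply: (@continuous_comp _ _ _ (fun z : R => `|z|) (fun y : R => c * y ^+ n)).
    exact: norm_continuous.
  apply: (@continuous_comp _ _ _ (fun y : R => y ^+ n) ( *%R c)).
    exact: exprn_continuous.
  exact: mulrl_continuous.
move=> z; apply: (@continuous_comp _ _ _ (fun z : R => c * `|z| ^+ n) (fM n alpha)).
  exact: cX.
exact: continuous_fM.
Qed.

Lemma measurable_fM_exprn u (c : R) : measurable_fun D u ->
  measurable_fun D (fun x => fM n alpha (c * `|u x| ^+ n)).
Proof.
move=> mu_.
exact: (measurableT_comp (continuous_measurable_fun (@continuous_fM_exprn c)) mu_).
Qed.

Lemma integral_trivial (F : R -> R) u : F 0 = 0 -> ~ nontrivial D u ->
  measurable_fun D u -> measurable_fun D (fun x => F (u x)) ->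
  (\int[mu]_(x in D) (F (u x))%:E = 0)%E.
Proof.
move=> F0 /contrapT u0 mu_ mF.
rewrite (ae_eq_integral (cst 0)%E); first exact: integral0.
- exact: mD.
- exact/measurable_EFinP.
- exact: measurable_cst.
- by apply: filterS u0 => x + Dx => /(_ Dx) /= ->; rewrite F0.
Qed.

Lemma integral_fM_trivial u c : ~ nontrivial D u -> measurable_fun D u ->
  (\int[mu]_(x in D) (fM n alpha (c * `|u x| ^+ n))%:E = 0)%E.
Proof.
move=> tu mu_; apply: (@integral_trivial (fun z => fM n alpha (c * `|z| ^+ n))).
- by rewrite normr0 expr0n gtn_eqF// mulr0 fM0.
- exact: tu.
- exact: mu_.
- exact: measurable_fM_exprn.
Qed.

(** For a trivial u, which the definition of K excludes, the left-hand side is 0, and [0 <= K]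
    closes the case. *)
Lemma moser_trudinger_ge0 u du : W1n0 D u du -> 0 <= K ->
  (\int[mu]_(x in D) (fM n alpha ((energy du)^-1 * `|u x| ^+ n))%:E <= K%:E * mu D)%E.
Proof.
move=> Wu K0; have [bound _] := K_optimal; have [[mu_ _ _ _ _] _] := Wu.
have [nu|tu] := pselect (nontrivial D u).
  have := bound _ _ Wu nu; rewrite grad_norm_exprn.
  by under eq_integral do rewrite mulrC.
have -> : (\int[mu]_(x in D) (fM n alpha ((energy du)^-1 * `|u x| ^+ n))%:E = 0)%E.
  exact: integral_fM_trivial.
by rewrite mule_ge0.
Qed.

(** The integral of [fM] is positive for a test function that is nonzero somewhere. Its positive
    energy matters: with energy 0 the quotient would be 0 everywhere, and [fM] vanishes at 0. *)
Lemma optimal_constant_gt0 : 0 < K /\ (0 < mu D)%E.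
Proof.
have [f [x [tf Dx fx]]] := exists_test_function.
have G0 := energy_test_gt0 tf fx.
have Wf := W1n0_test_function n_gt0 openD boundedD tf.
have muD : (0 < mu D)%E.
  apply: lebesgue_rV_open_gt0 => //; last by exists x.
  exact: (lebesgue_rV_setT_neq0).
split=> //; rewrite ltNge; apply/negP => K0.
have fM_gt0f : (0 < \int[mu]_(y in D)
    (fM n alpha ((energy (gradient f))^-1 * `|f y| ^+ n))%:E)%E.
  apply: (@integral_gt0_rV
    (fun y => fM n alpha ((energy (gradient f))^-1 * `|f y| ^+ n)) x) => //.
  - move=> y; apply: (@continuous_comp _ _ _ f (fun z : R => fM n alpha (_ * `|z| ^+ n))).
      by have [sf _ _] := tf; exact: smooth_continuous.
    exact: continuous_fM_exprn.
  - by move=> y _; exact: fM_ge0.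
  - by rewrite fM_gt0// mulr_gt0 ?invr_gt0// exprn_gt0// normr_gt0.
have nf : nontrivial D f.
  move: fM_gt0f; apply: contraPP => tf0.
  rewrite integral_fM_trivial; [by rewrite ltxx|exact: tf0|].
  exact: measurable_test_function.
have [bound _] := K_optimal; have := bound _ _ Wf nf.
rewrite leNgt => /negP; apply.
apply: (@le_lt_trans _ _ 0%E); first by rewrite mule_le0_ge0// lee_fin.
rewrite grad_norm_exprn.
by under eq_integral do rewrite mulrC.
Qed.

Let muDE : mu D = (volume D)%:E.
Proof. by rewrite /volume fineK// ge0_fin_numE// measure_ge0. Qed.

Let vol_gt0 : 0 < volume D.
Proof.
have [_] := optimal_constant_gt0.
by rewrite muDE lte_fin.
Qed.

Let K_gt0 : 0 < K.
Proof. by have [] := optimal_constant_gt0. Qed.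

Lemma integrable_moser_trudinger u du : W1n0 D u du ->
  mu.-integrable D (EFin \o (fun x => fM n alpha ((energy du)^-1 * `|u x| ^+ n))).
Proof.
move=> Wu; have [[mu_ _ _ _ _] _] := Wu.
apply: (@ge0_integrable_lty _ _ _ mu D
  (fun x => fM n alpha ((energy du)^-1 * `|u x| ^+ n)) _ _).2.
- exact: measurable_fM_exprn.
- by move=> x _; exact: fM_ge0.
- apply: le_lt_trans (moser_trudinger_ge0 Wu (ltW K_gt0)) _.
  by rewrite muDE -EFinM ltry.
Qed.

(** The tangent of [fM] at 1 has slope m = M'(1) > 0, whence m Y <= M(Y) + m for Y = |f|^n / energy.
    Integration gives the constant (K + m) |D| / m. *)
Lemma poincare_test_function : exists2 C, 0 <= C & forall f, test_function D f ->
  \int[mu]_(x in D) `|f x| ^+ n <= C * energy (gradient f).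
Proof.
have m0 := dM_gt0 n alpha_gt0 ltr01; set m := dM n alpha 1 in m0.
have C_ge0 : 0 <= m^-1 * ((K + m) * volume D).
  by apply: ltW; rewrite mulr_gt0 ?invr_gt0// mulr_gt0// addr_gt0.
exists (m^-1 * ((K + m) * volume D)) => //.
move=> f tf; have [[x [Dx fx]]|f0] := pselect (exists x, D x /\ f x != 0); last first.
  rewrite (@eq_Rintegral _ _ _ _ _ (cst 0)).
    by rewrite Rintegral_cst// mul0r mulr_ge0// energy_ge0.
  move=> x /set_mem Dx; suff -> : f x = 0 by rewrite normr0 expr0n gtn_eqF.
  by apply: contrapT => /eqP fx; apply: f0; exists x.
have G0 := energy_test_gt0 tf fx.
have Wf := W1n0_test_function n_gt0 openD boundedD tf.
have iM := integrable_moser_trudinger Wf.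
have MK := moser_trudinger_ge0 Wf (ltW K_gt0).
set G := energy (gradient f) in G0 iM MK *.
rewrite -(EFin_Rintegral mD iM) muDE -EFinM lee_fin in MK.
have iX := W1n_integrable_exprn (W1n_test_function openD boundedD tf).
have : \int[mu]_(x in D) (0 + (m * G^-1) * `|f x| ^+ n) <=
    \int[mu]_(x in D) (fM n alpha (G^-1 * `|f x| ^+ n) + m * (cst 1 x)).
  apply: le_Rintegral => //.
  - exact: (integrable_realDZ mD _ (integrable_cst_rV openD boundedD 0) iX).
  - exact: (integrable_realDZ mD _ iM (integrable_cst_rV openD boundedD 1)).
  move=> y _; rewrite add0r -mulrA mulr1.
  set Y := G^-1 * _; have := fM_tangent n_ge2 alpha_gt0 1 Y.
  have := fM_ge0 n_ge2 alpha_gt0 1; rewrite -/m mulrBr mulr1.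
  move: (fM n alpha 1) (fM n alpha Y) (m * Y) => a b c; lra.
rewrite (RintegralDZ mD _ (integrable_cst_rV openD boundedD 0) iX).
rewrite (RintegralDZ mD _ iM (integrable_cst_rV openD boundedD 1)).
rewrite !Rintegral_cst// mul0r add0r mul1r -/(volume D) => H.
have mG0 : 0 < m * G^-1 by rewrite mulr_gt0// invr_gt0.
rewrite -(ler_pM2l mG0) [leRHS](_ : _ = (K + m) * volume D); last first.
  by field; rewrite !gt_eqF.
by apply: (le_trans H); rewrite mulrDl lerD2r.
Qed.

(** As the energy of u is 0, that of a test function f close to u is small, hence so is the L^n norm
    of f by the Poincare inequality, and u is the sum of u - f and f. *)
Lemma energy_eq0_trivial u du : W1n0 D u du -> energy du = 0 -> ~ nontrivial D u.
Proof.
move=> Wu G0; have [Wu1 _] := Wu; have [mu_ _ _ _ _] := Wu1.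
have iu := W1n_integrable_exprn Wu1; have idu := W1n_integrable_gradient Wu1.
apply: trivial_integral0 => //.
have [C C0 poincare] := poincare_test_function.
apply/ler_addgt0Pl => e e0; rewrite addr0.
(* One factor 2^n comes from splitting |u|^n, the other from bounding the energy of f; C is the
   Poincare constant. *)
pose c := 2 ^+ n * (1 + C * 2 ^+ n).
have c0 : 0 < c by rewrite mulr_gt0 ?exprn_gt0// ltr_wpDr// mulr_ge0// exprn_ge0.
have [f [tf fu df]] := W1n0_approx n_gt0 openD boundedD Wu (divr_gt0 e0 c0).
have Wf := W1n_test_function openD boundedD tf.
have Ww := W1n_combination n_gt0 openD boundedD (-1) Wu1 tf.
have iw := W1n_integrable_exprn Ww; have idw := W1n_integrable_gradient Ww.
have iff := W1n_integrable_exprn Wf; have idf := W1n_integrable_gradient Wf.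
have i0 := integrable_cst_rV openD boundedD 0.
have Ef : energy (gradient f) <= 2 ^+ n * (e / c).
  apply: (@le_trans _ _ (\int[mu]_(x in D) (0 + 2 ^+ n *
      (enorm (du x + -1 *: gradient f x) ^+ n + 1 * enorm (du x) ^+ n)))).
    apply: le_Rintegral => //.
      exact: (integrable_realDZ mD _ i0 (integrable_realDZ mD 1 idw idu)).
    move=> x _; rewrite add0r mul1r.
    have gE : gradient f x = -1 *: (du x + -1 *: gradient f x) + du x.
      by rewrite !scaleN1r opprD opprK addrAC addNr add0r.
    rewrite [in leLHS]gE; apply: (le_trans (enormD_le_exp _ _ _)).
    by rewrite enormZ normrN1 mul1r.
  rewrite (RintegralDZ mD _ i0 (integrable_realDZ mD 1 idw idu)) (RintegralDZ mD _ idw idu).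
  rewrite Rintegral_cst// mul0r add0r mul1r -/(energy du) G0 addr0.
  by rewrite ler_pM2l ?exprn_gt0.
apply: (@le_trans _ _ (\int[mu]_(x in D) (0 + 2 ^+ n *
    (`|u x + -1 * f x| ^+ n + 1 * `|f x| ^+ n)))).
  apply: le_Rintegral => //.
    exact: (integrable_realDZ mD _ i0 (integrable_realDZ mD 1 iw iff)).
  move=> x _; rewrite add0r mul1r.
  apply: le_trans (exprD_le _ (normr_ge0 _) (normr_ge0 _)).
  apply: lerXn2r; rewrite ?nnegrE ?addr_ge0//.
  by have := ler_normD (u x + -1 * f x) (f x); rewrite mulN1r subrK.
rewrite (RintegralDZ mD _ i0 (integrable_realDZ mD 1 iw iff)) (RintegralDZ mD _ iw iff).
rewrite Rintegral_cst// mul0r add0r mul1r.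
have -> : e = 2 ^+ n * (e / c + C * (2 ^+ n * (e / c))).
  by rewrite -{1}(divfK (lt0r_neq0 c0) e); move: (e / c) => q; rewrite /c; ring.
rewrite ler_pM2l ?exprn_gt0// lerD// (le_trans (poincare _ tf))//.
by rewrite ler_wpM2l.
Qed.

Lemma energy_gt0 u du : W1n0 D u du -> nontrivial D u -> 0 < energy du.
Proof.
move=> Wu nu; rewrite lt_neqAle energy_ge0 andbT eq_sym.
by apply/eqP => /(energy_eq0_trivial Wu).
Qed.

(** * Integrated Young inequality *)

Lemma measurable_fN_comp f : measurable_fun D f ->
  measurable_fun D (fun x => fN n alpha (f x)).
Proof.
move=> mf.
exact: (measurableT_comp (continuous_measurable_fun (@continuous_fN R n alpha n_ge2)) mf).
Qed.

Lemma measurable_exprn_norm u : measurable_fun D u ->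
  measurable_fun D (fun x => `|u x| ^+ n).
Proof.
move=> mu_; exact: (measurable_funX _ (measurableT_comp (@normr_measurable _ _) mu_)).
Qed.

(* Young's inequality for the conjugate pair [fM, fN], applied to
   [f x] and [|w x|^n / energy dw]. *)
Lemma weighted_energy_le w dw f : W1n0 D w dw -> measurable_fun D f ->
  (forall x, D x -> 0 <= f x) ->
  (\int[mu]_(x in D) (f x * `|w x| ^+ n)%:E <=
   (energy dw)%:E * (K%:E * mu D + \int[mu]_(x in D) (fN n alpha (f x))%:E))%E.
Proof.
move=> Ww mf f0; have [[mw _ _ _ _] _] := Ww.
have mfw : measurable_fun D (fun x => f x * `|w x| ^+ n).
  exact: (measurable_funM mf (measurable_exprn_norm mw)).
have mN := measurable_fN_comp mf.
have N0 : (0 <= \int[mu]_(x in D) (fN n alpha (f x))%:E)%E.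
  by apply: integral_ge0 => x _; rewrite lee_fin fN_ge0.
have [nw|tw] := pselect (nontrivial D w); last first.
  have -> : (\int[mu]_(x in D) (f x * `|w x| ^+ n)%:E = 0)%E.
    rewrite (ae_eq_integral (cst 0)%E); first exact: integral0.
    - exact: mD.
    - exact/measurable_EFinP.
    - exact: measurable_cst.
    - move/contrapT : tw; apply: filterS => x + Dx => /(_ Dx) /= ->.
      by rewrite normr0 expr0n gtn_eqF// mulr0.
  rewrite mule_ge0 ?lee_fin ?energy_ge0// adde_ge0// mule_ge0// lee_fin ltW//.
have G0 := energy_gt0 Ww nw.
have MK := moser_trudinger_ge0 Ww (ltW K_gt0).
set G := energy dw in G0 MK *.
have mM : measurable_fun D (fun x => fM n alpha (G^-1 * `|w x| ^+ n)).
  exact: measurable_fM_exprn.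
apply: (@le_trans _ _ (\int[mu]_(x in D)
    (G%:E * ((fM n alpha (G^-1 * `|w x| ^+ n))%:E + (fN n alpha (f x))%:E)))%E).
  apply: ge0_le_integral.
  - exact: mD.
  - by move=> x Dx; rewrite lee_fin mulr_ge0 ?f0// exprn_ge0.
  - exact/measurable_EFinP.
  - apply/measurable_EFinP.
    exact: (measurable_funM (measurable_cst G) (measurable_funD mM mN)).
  - move=> x Dx; rewrite -EFinD -EFinM lee_fin.
    rewrite -ler_pdivrMl// mulrA mulrAC; apply: young_le => //; exact: f0.
rewrite ge0_integralZl_EFin; last 4 first.
- exact: mD.
- by move=> x _; rewrite adde_ge0// lee_fin ?fM_ge0 ?fN_ge0.
- exact/measurable_EFinP/(measurable_funD mM mN).
- exact: ltW.
apply: lee_wpmul2l; first by rewrite lee_fin ltW.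
rewrite ge0_integralD; first exact: leeD.
- exact: mD.
- by move=> x _; rewrite lee_fin fM_ge0.
- exact/measurable_EFinP.
- by move=> x _; rewrite lee_fin fN_ge0.
- exact/measurable_EFinP.
Qed.

(* Subtracting a bounded test function makes the energy arbitrarily small, so
   any multiple of |u|^n is within reach of the Moser-Trudinger bound. *)
Lemma integral_fM_double_lty u du : W1n0 D u du ->
  (\int[mu]_(x in D) (fM n alpha (2 * `|u x| ^+ n))%:E < +oo)%E.
Proof.
move=> Wu; have [[mu_ _ _ _ _] _] := Wu.
(* From |u| <= 2 max(B, |w|) one gets 2 |u|^n <= 2^(n+1) max(B, |w|)^n. Energy at most 2^-(n+1) puts
   the coefficient 2^(n+1) below the inverse energy of w. *)
have e0 : 0 < 2 ^- n.+1 :> R by rewrite invr_gt0 exprn_gt0.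
have [f [tf _ Ge]] := W1n0_approx n_gt0 openD boundedD Wu e0.
have Ww := W1n0_combination n_gt0 openD boundedD (-1) Wu tf.
set w := (fun x => u x + -1 * f x) in Ww; have [[mw _ _ _ _] _] := Ww.
have mMw c : measurable_fun D (fun x => fM n alpha (c * `|w x| ^+ n)).
  exact: measurable_fM_exprn.
have [B B0 fB] := test_function_bounded tf.
set dw := (fun x => du x + -1 *: gradient f x) in Ww Ge.
have Moo : (\int[mu]_(x in D) (fM n alpha (2 ^+ n.+1 * `|w x| ^+ n))%:E < +oo)%E.
  have [nw|tw] := pselect (nontrivial D w); last by rewrite integral_fM_trivial// ltry.
  have G0 := energy_gt0 Ww nw.
  have MK := moser_trudinger_ge0 Ww (ltW K_gt0).
  apply: le_lt_trans (le_trans _ MK) _; last by rewrite muDE -EFinM ltry.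
  apply: ge0_le_integral.
  - exact: mD.
  - by move=> x _; rewrite lee_fin fM_ge0.
  - exact/measurable_EFinP/measurable_fM_exprn.
  - exact/measurable_EFinP/measurable_fM_exprn.
  - move=> x _; rewrite lee_fin; apply: fM_homo => //.
    by rewrite ler_wpM2r ?exprn_ge0// -[leLHS]invrK lef_pV2 ?posrE.
apply: (@le_lt_trans _ _ (\int[mu]_(x in D)
  ((fM n alpha (2 ^+ n.+1 * B ^+ n))%:E + (fM n alpha (2 ^+ n.+1 * `|w x| ^+ n))%:E))%E).
  apply: ge0_le_integral.
  - exact: mD.
  - by move=> x _; rewrite lee_fin fM_ge0.
  - exact/measurable_EFinP/measurable_fM_exprn.
  - apply/measurable_EFinP.
    exact: (measurable_funD (measurable_cst _) (mMw _)).
  - move=> x _; rewrite -EFinD lee_fin.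
    have uwB : `|u x| <= 2 * Num.max B `|w x|.
      have := ler_normD (w x) (f x); rewrite /w mulN1r subrK.
      have := fB x; have : B <= Num.max B `|u x - f x| by rewrite le_max lexx.
      have : `|u x - f x| <= Num.max B `|u x - f x| by rewrite le_max lexx orbT.
      lra.
    have [wB|Bw] := leP `|w x| B.
      rewrite max_l// in uwB; apply: (@le_trans _ _ (fM n alpha (2 ^+ n.+1 * B ^+ n))).
        apply: fM_homo => //; rewrite exprS -mulrA -exprMn ler_pM2l//.
        by apply: lerXn2r; rewrite ?nnegrE ?mulr_ge0.
      by rewrite lerDl fM_ge0.
    rewrite max_r ?(ltW Bw)// in uwB.
    apply: (@le_trans _ _ (fM n alpha (2 ^+ n.+1 * `|w x| ^+ n))).
      apply: fM_homo => //; rewrite exprS -mulrA -exprMn ler_pM2l//.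
      by apply: lerXn2r; rewrite ?nnegrE ?mulr_ge0.
    by rewrite lerDr fM_ge0.
rewrite ge0_integralD; last 5 first.
- exact: mD.
- by move=> x _; rewrite lee_fin fM_ge0.
- exact: measurable_cst.
- by move=> x _; rewrite lee_fin fM_ge0.
- exact/measurable_EFinP/measurable_fM_exprn.
apply: lte_add_pinfty; last exact: Moo.
have ic := integrable_cst_rV openD boundedD (fM n alpha (2 ^+ n.+1 * B ^+ n)).
apply: (@ge0_integrable_lty _ _ _ mu D _ _ _).1 ic => //.
by move=> x _; exact: fM_ge0.
Qed.

(** * Lower bound for the Orlicz norm *)

Let KvolD_gt0 : 0 < K * volume D.
Proof.
have [_] := optimal_constant_gt0.
by rewrite muDE lte_fin; exact: mulr_gt0.
Qed.

(** Isolates what a solution with weight V_+ and an extremal with its own potential have in common.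
    Each l in the infimum is treated separately, with Young's inequality for the weight |V| / l; the
    energy then cancels. *)
Lemma norm_N_ge1 w dw (V : 'rV[R]_n -> R) : W1n0 D w dw -> 0 < energy dw ->
  measurable_fun D V ->
  ((energy dw)%:E <= \int[mu]_(x in D) (`|V x| * `|w x| ^+ n)%:E)%E ->
  (1 <= (K * volume D)%:E * norm_N alpha D K V)%E.
Proof.
move=> Ww G0 mV GV; have [[mw _ _ _ _] _] := Ww.
have mVn : measurable_fun D (fun x => `|V x|).
  exact: (measurableT_comp (@normr_measurable R setT) mV).
suff H : (((K * volume D)^-1)%:E <= norm_N alpha D K V)%E.
  have := @lee_wpmul2l R (K * volume D)%:E _ _ _ H.
  by rewrite lee_fin ltW// -EFinM mulfV ?gt_eqF// => /(_ isT).
apply: le_ereal_inf_tmp => _ [l /= l0 <-].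
have mVl : measurable_fun D (fun x => `|V x| / l).
  exact: (measurable_funM mVn (measurable_cst _)).
have H : forall x, D x -> 0 <= `|V x| / l by move=> x _; rewrite divr_ge0// ltW.
have := weighted_energy_le Ww mVl H.
set I := (\int[mu]_(x in D) (fN _ _ _)%:E)%E.
have I0 : (0 <= I)%E by apply: integral_ge0 => x _; rewrite lee_fin fN_ge0.
have -> : (\int[mu]_(x in D) (`|V x| / l * `|w x| ^+ n)%:E =
    l^-1%:E * \int[mu]_(x in D) (`|V x| * `|w x| ^+ n)%:E)%E.
  rewrite -ge0_integralZl_EFin.
  - by apply: eq_integral => x _; rewrite -EFinM; congr EFin; ring.
  - exact: mD.
  - by move=> x _; rewrite lee_fin mulr_ge0// exprn_ge0.
  - apply/measurable_EFinP; exact: (measurable_funM mVn (measurable_exprn_norm mw)).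
  - by rewrite invr_ge0 ltW.
have := @lee_wpmul2l _ l^-1%:E _ _ _ GV; rewrite lee_fin invr_ge0 (ltW l0) => /(_ isT) GV'.
move=> /(le_trans GV'); rewrite muDE.
(* The cancellation takes place among reals; when I is infinite, this l contributes +oo to the
   infimum. *)
have [Ioo|Ifin] := eqVneq I +oo%E.
  by move=> _; rewrite Ioo gt0_muley ?lte_fin ?divr_gt0// addey// leey.
have /fineK <- : I \is a fin_num by rewrite ge0_fin_numE// lt_neqAle Ifin leey.
rewrite -!EFinM -!EFinD !lee_fin mulrC ler_pM2l// => lK.
have l1 : 1 <= l * (K * volume D + fine I) by rewrite -ler_pdivrMl// mulr1.
rewrite -(ler_pM2l KvolD_gt0) mulfV ?gt_eqF// (le_trans l1)//.
have := lt0r_neq0 KvolD_gt0; rewrite mulf_eq0 negb_or => /andP[K0 v0].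
by rewrite le_eqVlt; apply/orP; left; apply/eqP; field; rewrite K0 v0.
Qed.

(** The argument [alpha * s] compensates the division by alpha in [fN], so that the L log^(n-1) L
    condition bounds the integral of N(alpha |V|) directly. *)
Lemma fN_LlogL (s : R) : 0 <= s -> fN n alpha (alpha * s) <= s * ln (1 + s) ^+ n.-1.
Proof.
move=> s0; have as0 : 0 <= alpha * s by rewrite mulr_ge0// ltW.
apply: le_trans (fN_le n_ge2 alpha_gt0 as0) _.
rewrite /dN (mulrC alpha s) mulfK ?gt_eqF// max_l// (addrC s).
rewrite le_eqVlt; apply/orP; left; apply/eqP; field.
by rewrite gt_eqF.
Qed.

Lemma LlogL_weight_le (V : 'rV[R]_n -> R) : in_LlogL D V -> exists2 C, 0 <= C &
  forall w dw, W1n0 D w dw ->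
  mu.-integrable D (EFin \o (fun x => `|V x| * `|w x| ^+ n)) /\
  \int[mu]_(x in D) (`|V x| * `|w x| ^+ n) <= C * energy dw.
Proof.
move=> [mV Voo]; have mVn : measurable_fun D (fun x => `|V x|).
  exact: (measurableT_comp (@normr_measurable R setT) mV).
have mVa : measurable_fun D (fun x => alpha * `|V x|).
  exact: (measurable_funM (measurable_cst _) mVn).
set I := (\int[mu]_(x in D) (fN n alpha (alpha * `|V x|))%:E)%E.
have I0 : (0 <= I)%E by apply: integral_ge0 => x _; rewrite lee_fin fN_ge0.
have Ioo : (I < +oo)%E.
  apply: le_lt_trans Voo; apply: ge0_le_integral.
  - exact: mD.
  - by move=> x _; rewrite lee_fin fN_ge0.
  - exact/measurable_EFinP/measurable_fN_comp.
  - apply/measurable_EFinP.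
    have mln : measurable_fun D (fun x => ln (1 + `|V x|)).
      exact: (measurableT_comp (@measurable_ln R) (measurable_funD (measurable_cst _) mVn)).
    exact: (measurable_funM mVn (measurable_funX _ mln)).
  - by move=> x _; rewrite lee_fin; exact: fN_LlogL.
have KvI0 : 0 <= K * volume D + fine I.
  by rewrite addr_ge0 ?fine_ge0// ltW// mulr_gt0.
have ai0 : 0 <= alpha^-1 by rewrite invr_ge0 ltW.
(* Young's inequality is applied with the weight alpha |V|, hence the division by alpha. *)
exists (alpha^-1 * (K * volume D + fine I)); first by rewrite mulr_ge0.
move=> w dw Ww; have [[mw _ _ _ _] _] := Ww.
have H : forall x, D x -> 0 <= alpha * `|V x| by move=> x _; rewrite mulr_ge0// ltW.
have := weighted_energy_le Ww mVa H.
rewrite -/I -(@fineK _ I) ?ge0_fin_numE// muDE -!EFinM => H1.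
have : (\int[mu]_(x in D) (`|V x| * `|w x| ^+ n)%:E <=
    (alpha^-1 * (K * volume D + fine I) * energy dw)%:E)%E.
  rewrite -mulrA EFinM (mulrC _ (energy dw)).
  apply: le_trans (lee_wpmul2l (_ : 0 <= alpha^-1%:E)%E H1); last by rewrite lee_fin.
  rewrite -ge0_integralZl_EFin.
  - rewrite le_eqVlt; apply/orP; left; apply/eqP.
    by apply: eq_integral => x _; rewrite -EFinM; congr EFin; field; rewrite gt_eqF.
  - exact: mD.
  - by move=> x _; rewrite lee_fin mulr_ge0 ?exprn_ge0// mulr_ge0// ltW.
  - apply/measurable_EFinP; exact: (measurable_funM mVa (measurable_exprn_norm mw)).
  - exact: ai0.
move=> CV; have mVw : measurable_fun D (fun x => `|V x| * `|w x| ^+ n).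
  exact: (measurable_funM mVn (measurable_exprn_norm mw)).
have iVw : mu.-integrable D (EFin \o (fun x => `|V x| * `|w x| ^+ n)).
  apply: (@ge0_integrable_lty _ _ _ mu D _ mVw _).2.
    by move=> x _; rewrite mulr_ge0// exprn_ge0.
  exact: le_lt_trans CV (ltry _).
by split => //; rewrite -lee_fin (EFin_Rintegral mD iVw).
Qed.

(** For a test function f near u and w = u - f, testing with f leaves the integral of |du|^(n-2)
    du.dw minus that of V |u|^(n-2) u w. Young's inequality with a small parameter d bounds both by
    terms in u with factor d and terms in w with factor d^-(n-1). *)
Lemma solution_energy_le (V u : 'rV[R]_n -> R) du : in_LlogL D V -> W1n0 D u du ->
  n_laplace_eq D du (fun x => V x * `|u x| ^+ (n - 2) * u x) ->
  energy du <= \int[mu]_(x in D) (V x * `|u x| ^+ n).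
Proof.
move=> VL Wu equ; have [mV _] := VL; have [Wu1 _] := Wu.
have [mu_ mdu _ _ _] := Wu1.
have [C C0 iVw] := LlogL_weight_le VL.
have [iVu Vu] := iVw _ _ Wu.
have iVu' : mu.-integrable D (EFin \o (fun x => V x * `|u x| ^+ n)).
  apply: (@le_integrable_real _ _ _ _ _ mD _ (fun x => `|V x| * `|u x| ^+ n)).
  - exact: (measurable_funM mV (measurable_exprn_norm mu_)).
  - by move=> x _; rewrite normrM normrX normr_id.
  - exact: iVu.
have iA := W1n_integrable_gradient Wu1.
have G0 := energy_ge0 du; set G := energy du in G0 Vu *.
apply/ler_addgt0Pl => e e0.
(* The four error terms of the final estimate are d G, d, d C G and d C, with sum d c. The choice of
   d makes this e / 2, and d' = d^n offsets the factor d^-(n-1) in front of the terms in w. *)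
pose c := (1 + C) * (G + 1).
have c0 : 0 < c by apply: mulr_gt0; [rewrite ltr_pwDl|rewrite ltr_wpDl].
pose d := e / 2 / c; have d0 : 0 < d by rewrite !divr_gt0.
pose d' := d ^+ n.-1 * d.
have d'0 : 0 < d' by rewrite mulr_gt0// exprn_gt0.
have [f [tf _ Gw]] := W1n0_approx n_gt0 openD boundedD Wu d'0.
have Ww := W1n0_combination n_gt0 openD boundedD (-1) Wu tf.
have [iVf Vf] := iVw _ _ Ww; have [Ww1 _] := Ww; have [mw _ _ _ _] := Ww1.
have iB := W1n_integrable_gradient Ww1.
have [i1 i2 eq12] := equ _ tf.
set w := (fun x => u x + -1 * f x) in Ww Ww1 mw iVf Vf iB *.
set dw := (fun x => du x + -1 *: gradient f x) in Ww Ww1 mw iVf Vf iB Gw *.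
pose lhs x := enorm (du x) ^+ (n - 2) * dotp (du x) (gradient f x).
pose rhs x := V x * `|u x| ^+ (n - 2) * u x * f x.
have E : G - \int[mu]_(x in D) (V x * `|u x| ^+ n) =
    \int[mu]_(x in D) ((enorm (du x) ^+ n + -1 * lhs x) + -1 * (V x * `|u x| ^+ n + -1 * rhs x)).
  have iP := integrable_realDZ mD (-1) iA i1.
  have iQ := integrable_realDZ mD (-1) iVu' i2.
  rewrite (RintegralDZ mD _ iP iQ) (RintegralDZ mD _ iA i1) (RintegralDZ mD _ iVu' i2).
  have eq12' : \int[mu]_(x in D) lhs x = \int[mu]_(x in D) rhs x := eq12.
  rewrite -/(energy du) -/G eq12'.
  move: (\int[mu]_(x in D) rhs x) (\int[mu]_(x in D) (V x * _)) => a b; ring.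
rewrite -lerBlDr {}E; apply: (@le_trans _ _ (e / 2)); last first.
  by rewrite ler_pdivrMr// ler_peMr ?ler1n// ltW.
have i0 := integrable_cst_rV openD boundedD 0.
have j1 := integrable_realDZ mD d i0 iA.
have j2 := integrable_realDZ mD (d ^- n.-1) j1 iB.
have j3 := integrable_realDZ mD d j2 iVu.
have j4 := integrable_realDZ mD (d ^- n.-1) j3 iVf.
have iPQ := integrable_realDZ mD (-1) (integrable_realDZ mD (-1) iA i1)
  (integrable_realDZ mD (-1) iVu' i2).
have exprn2 (y : R) : y ^+ n = y ^+ (n - 2) * y ^+ 2 by rewrite -exprD subnK.
have exprn1 (y : R) : y ^+ n.-1 = y ^+ (n - 2) * y.
  by rewrite -exprSr -subSn// subSS subn1.
have young (a b : R) : 0 <= a -> 0 <= b ->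
    a ^+ n.-1 * b <= d * a ^+ n + d ^- n.-1 * b ^+ n.
  by move=> a0 b0; have := exprn_young_eps n.-1 a0 b0 d0; rewrite prednK.
apply: (@le_trans _ _ _ _ _ (le_Rintegral mD iPQ j4 _)).
  move=> x _ /=.
  have Pdw : enorm (du x) ^+ n + -1 * lhs x <=
      d * enorm (du x) ^+ n + d ^- n.-1 * enorm (dw x) ^+ n.
    apply: le_trans (young _ _ (enorm_ge0 _) (enorm_ge0 _)).
    rewrite /lhs {1}exprn2 enorm_sqr mulrCA -mulrDr exprn1 -mulrA.
    rewrite ler_wpM2l ?exprn_ge0 ?enorm_ge0//.
    rewrite -dotpZr -dotpDr; exact: le_trans (ler_norm _) (normr_dotp_le _ _).
  have Qw : -1 * (V x * `|u x| ^+ n + -1 * rhs x) <=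
      `|V x| * (d * `|u x| ^+ n + d ^- n.-1 * `|w x| ^+ n).
    apply: (@le_trans _ _ (`|V x| * (`|u x| ^+ n.-1 * `|w x|))); last first.
      by rewrite ler_wpM2l// young.
    have -> : -1 * (V x * `|u x| ^+ n + -1 * rhs x) =
        - (V x * (`|u x| ^+ (n - 2) * (u x * w x))).
      by rewrite /rhs /w exprn2 real_normK ?num_real//; ring.
    apply: le_trans (ler_norm _) _.
    by rewrite normrN !normrM normrX normr_id exprn1 -!mulrA.
  apply: (le_trans (lerD Pdw Qw)); rewrite le_eqVlt; apply/orP; left; apply/eqP; ring.
rewrite (RintegralDZ mD _ j3 iVf) (RintegralDZ mD _ j2 iVu) (RintegralDZ mD _ j1 iB).
rewrite (RintegralDZ mD _ i0 iA) Rintegral_cst// mul0r add0r -/(energy du) -/G -/(energy dw).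
have -> : e / 2 = d * G + d ^- n.-1 * d' + d * (C * G) + d ^- n.-1 * (C * d').
  have dd : d ^- n.-1 * d' = d by rewrite /d' mulrA mulVf ?mul1r// expf_neq0// gt_eqF.
  rewrite (mulrCA (d ^- n.-1) C d') dd.
  have -> : e / 2 = d * c by rewrite /d divfK// gt_eqF.
  by rewrite /c; ring.
have dn0 : 0 <= d ^- n.-1 by rewrite invr_ge0 exprn_ge0// ltW.
apply: lerD; first apply: lerD; first apply: lerD => //.
- by rewrite ler_wpM2l.
- by rewrite ler_wpM2l// ltW.
- by rewrite ler_wpM2l// (le_trans Vf)// ler_wpM2l.
Qed.

Lemma solution_norm_N_ge1 (V u : 'rV[R]_n -> R) du : in_LlogL D V -> W1n0 D u du ->
  nontrivial D u -> n_laplace_eq D du (fun x => V x * `|u x| ^+ (n - 2) * u x) ->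
  (1 <= (K * volume D)%:E * norm_N alpha D K (pos_part V))%E.
Proof.
move=> VL Wu nu equ; have [mV _] := VL; have [[mu_ _ _ _ _] _] := Wu.
have mVp : measurable_fun D (pos_part V).
  exact: (measurable_maxr mV (measurable_cst _)).
apply: (norm_N_ge1 Wu (energy_gt0 Wu nu) mVp).
have [C C0 iVw] := LlogL_weight_le VL.
have [iVu _] := iVw _ _ Wu; have mX := measurable_exprn_norm mu_.
have mVpn : measurable_fun D (fun x => `|pos_part V x|).
  exact: (measurableT_comp (@normr_measurable R setT) mVp).
have iV : mu.-integrable D (EFin \o (fun x => V x * `|u x| ^+ n)).
  apply: (le_integrable_real mD (measurable_funM mV mX) _ iVu) => x _.
  by rewrite normrM normrX normr_id.
have iVp : mu.-integrable D (EFin \o (fun x => `|pos_part V x| * `|u x| ^+ n)).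
  apply: (le_integrable_real mD (measurable_funM mVpn mX) _ iVu) => x _.
  rewrite normrM normr_id normrX normr_id ler_wpM2r ?exprn_ge0// /pos_part.
  by have [_|_] := leP (V x) 0; rewrite ?normr0.
rewrite -(EFin_Rintegral mD iVp) lee_fin; apply: le_trans (solution_energy_le VL Wu equ) _.
apply: (le_Rintegral mD iV iVp) => x _; rewrite ler_wpM2r ?exprn_ge0//.
by rewrite (le_trans _ (ler_norm _))// /pos_part le_max lexx.
Qed.

Lemma measurable_dM : measurable_fun setT (dM n alpha).
Proof.
by apply: nondecreasing_measurable; [exact: measurableT|exact: dM_homo].
Qed.

Lemma ae_eq_EFin_integral (g h : 'rV[R]_n -> R) : measurable_fun D g ->
  measurable_fun D h -> {ae mu, forall x, D x -> g x = h x} ->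
  (\int[mu]_(x in D) (g x)%:E = \int[mu]_(x in D) (h x)%:E)%E.
Proof.
move=> mg mh gh; apply: ae_eq_integral.
- exact: mD.
- exact/measurable_EFinP.
- exact/measurable_EFinP.
- by apply: filterS gh => x + Dx => /(_ Dx) /= ->.
Qed.

(** * Convergence of the flux along a variation *)

Section gradient_flux.
Variables (du : 'rV[R]_n -> 'rV[R]_n) (psi : 'rV[R]_n -> R) (s : R).
Hypotheses (mdu : forall i, measurable_fun D (fun x => du x 0 i))
  (idu : mu.-integrable D (EFin \o (fun x => enorm (du x) ^+ n)))
  (tpsi : test_function D psi) (s1 : `|s| <= 1).

(** The gradients of u + (s / (k + 1)) psi. The values s = 1 and s = -1 provide the two one-sided
    variations. *)
Definition perturbed_gradient k x := du x + (s * k.+1%:R^-1) *: gradient psi x.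

(** The derivative of |F|^n / n in the direction of the gradient of psi. *)
Definition flux (F : 'rV[R]_n -> 'rV[R]_n) x :=
  enorm (F x) ^+ (n - 2) * dotp (F x) (gradient psi x).

Lemma measurable_flux (F : 'rV[R]_n -> 'rV[R]_n) :
  (forall i, measurable_fun D (fun x => F x 0 i)) ->
  measurable_fun D (flux F).
Proof.
move=> mF; apply: measurable_funM.
  exact: (measurable_funX _ (measurable_enorm mF)).
exact: (measurable_dotp mF (fun i => measurable_gradient i tpsi)).
Qed.

Lemma flux_le (F : 'rV[R]_n -> 'rV[R]_n) M x : 0 <= M -> enorm (gradient psi x) <= M ->
  enorm (F x) <= enorm (du x) + M ->
  `|flux F x| <= 0 + (2 ^+ n * M) * ((1 + M) ^+ n + 1 * enorm (du x) ^+ n).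
Proof.
move=> M0 psiM FM; have F0 := enorm_ge0 (F x); have d0 := enorm_ge0 (du x).
rewrite add0r mul1r /flux normrM (ger0_norm (exprn_ge0 _ F0)).
apply: (@le_trans _ _ (enorm (F x) ^+ (n - 2) * (enorm (F x) * M))).
  rewrite ler_wpM2l ?exprn_ge0// (le_trans (normr_dotp_le _ _))//.
  by rewrite ler_wpM2l.
rewrite mulrA -exprSr [2 ^+ n * M]mulrC -mulrA [M * _]mulrC ler_wpM2r//.
apply: le_trans (exprD_le n (_ : 0 <= 1 + M) d0); last by rewrite addr_ge0.
(* The summand 1 keeps the base at least 1, so the exponent n - 1 may be raised to n, the power for
   which |du| is integrable. *)
apply: (@le_trans _ _ ((1 + M + enorm (du x)) ^+ (n - 2).+1)).
  apply: lerXn2r; rewrite ?nnegrE ?addr_ge0//.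
  by rewrite (le_trans FM)// addrC -addrA lerDr.
apply: ler_weXn2l; first by rewrite -addrA lerDl addr_ge0.
by rewrite -subSn// subSS leq_subr.
Qed.

Lemma integrable_flux_dominant M :
  mu.-integrable D (EFin \o (fun x =>
    0 + (2 ^+ n * M) * ((1 + M) ^+ n + 1 * enorm (du x) ^+ n))).
Proof.
apply: (integrable_realDZ mD _ (integrable_cst_rV openD boundedD 0)).
exact: (integrable_realDZ mD 1 (integrable_cst_rV openD boundedD ((1 + M) ^+ n)) idu).
Qed.

Lemma perturbed_gradient_le M k x : enorm (gradient psi x) <= M ->
  enorm (perturbed_gradient k x) <= enorm (du x) + M.
Proof.
move=> psiM; apply: (le_trans (enormD_le _ _)); rewrite lerD2l enormZ.
apply: le_trans psiM; rewrite ler_piMl ?enorm_ge0// normrM.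
rewrite (@ger0_norm _ k.+1%:R^-1)//.
by rewrite mulr_ile1// invf_le1// ler1n.
Qed.

Lemma measurable_perturbed_gradient k i :
  measurable_fun D (fun x => perturbed_gradient k x 0 i).
Proof.
under eq_fun do rewrite row_combinationE.
exact: (measurable_funD (mdu i)
  (measurable_funM (measurable_cst _) (measurable_gradient i tpsi))).
Qed.

Lemma integrable_flux_gradient : mu.-integrable D (EFin \o flux du).
Proof.
have [M M0 psiM] := test_function_gradient_bounded tpsi.
apply: (le_integrable_real mD (measurable_flux mdu) _ (integrable_flux_dominant M)).
by move=> x _; apply: flux_le => //; rewrite lerDl.
Qed.

Lemma integrable_flux_perturbed k :
  mu.-integrable D (EFin \o flux (perturbed_gradient k)).
Proof.
have [M M0 psiM] := test_function_gradient_bounded tpsi.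
apply: (le_integrable_real mD (measurable_flux (measurable_perturbed_gradient k)) _
  (integrable_flux_dominant M)).
by move=> x _; apply: flux_le => //; exact: perturbed_gradient_le.
Qed.

Lemma cvg_flux_pointwise x : flux (perturbed_gradient k) x @[k --> \oo] --> flux du x.
Proof.
pose a := du x; pose b := gradient psi x.
have cline (c d : R) : continuous (fun t : R => c + t * d).
  by move=> t; exact: cvgD (cvg_cst c) (cvgM cvg_id (cvg_cst d)).
have cE : continuous (fun t : R => enorm (a + t *: b)).
  apply: continuous_enorm_comp => i; under eq_fun do rewrite row_combinationE.
  exact: cline.
have cD : continuous (fun t : R => dotp (a + t *: b) b).
  under eq_fun do rewrite dotpDl dotpZl.
  exact: cline.
have cX : continuous (fun t : R => enorm (a + t *: b) ^+ (n - 2)).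
  move=> t; apply: (@continuous_comp _ _ _ (fun t : R => enorm (a + t *: b))
    (fun y : R => y ^+ (n - 2))).
    exact: cE.
  exact: exprn_continuous.
have ch : {for 0, continuous (fun t : R => enorm (a + t *: b) ^+ (n - 2) * dotp (a + t *: b) b)}.
  exact: cvgM (cX 0) (cD 0).
have s0 : s * k.+1%:R^-1 @[k --> \oo] --> (0 : R).
  by rewrite -[X in _ --> X](mulr0 s); exact: cvgM (cvg_cst s) (@cvg_harmonic R).
have H := continuous_cvg _ ch s0; rewrite /= scale0r addr0 in H.
exact: H.
Qed.

Lemma cvg_flux : (\int[mu]_(x in D) flux (perturbed_gradient k) x) @[k --> \oo] -->
  \int[mu]_(x in D) flux du x.
Proof.
have [M M0 psiM] := test_function_gradient_bounded tpsi.
have H : (\int[mu]_(x in D) (flux (perturbed_gradient k) x)%:E)%E @[k --> \oo] -->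
    (\int[mu]_(x in D) (flux du x)%:E)%E.
  apply: (@dominated_cvg _ _ _ mu D mD (fun k x => (flux (perturbed_gradient k) x)%:E)
    (fun x => (flux du x)%:E)
    (fun x => (0 + (2 ^+ n * M) * ((1 + M) ^+ n + 1 * enorm (du x) ^+ n))%:E)).
  - by move=> k; apply/measurable_EFinP/measurable_flux => i; exact: measurable_perturbed_gradient.
  - move=> x _; apply: cvg_EFin; first exact: nearW.
    exact: cvg_flux_pointwise.
  - by [].
  - exact: (integrable_flux_dominant M).
  - move=> k x _; rewrite abse_EFin lee_fin; apply: flux_le => //.
    exact: perturbed_gradient_le.
rewrite -(EFin_Rintegral mD integrable_flux_gradient) in H.
have H' := fine_cvg H.
exact: H'.
Qed.

End gradient_flux.

(** * Extremals: Euler-Lagrange equation and equality *)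

Section extremal_function.
Variables (u : 'rV[R]_n -> R) (du : 'rV[R]_n -> 'rV[R]_n).
Hypothesis ext : extremal alpha D K u du.

Let Wu : W1n0 D u du. Proof. by case: ext. Qed.

Let mu_ : measurable_fun D u. Proof. by case: Wu => -[]. Qed.

Let u0 : {ae mu, forall x, D x -> 0 <= u x}. Proof. by case: ext. Qed.

Let energy1 : energy du = 1.
Proof. by case: ext => _ _ g1 _; rewrite -grad_norm_exprn// g1 expr1n. Qed.

(** Built on |u| because u is nonnegative only almost everywhere; Young's equality then holds at
    every point. *)
Definition extremal_weight (x : 'rV[R]_n) : R := dM n alpha (`|u x| ^+ n).

Definition extremal_mass : R := \int[mu]_(x in D) (extremal_weight x * `|u x| ^+ n).

Local Notation f := extremal_weight.
Local Notation A := extremal_mass.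

Lemma measurable_extremal_weight : measurable_fun D f.
Proof. exact: (measurableT_comp measurable_dM (measurable_exprn_norm mu_)). Qed.

Lemma extremal_weight_ge0 x : 0 <= f x.
Proof. exact: dM_ge0. Qed.

Let mfu : measurable_fun D (fun x => f x * `|u x| ^+ n).
Proof. exact: (measurable_funM measurable_extremal_weight (measurable_exprn_norm mu_)). Qed.

Lemma integrable_extremal_mass :
  mu.-integrable D (EFin \o (fun x => f x * `|u x| ^+ n)).
Proof.
apply: (@ge0_integrable_lty _ _ _ mu D _ mfu _).2.
  by move=> x _; rewrite mulr_ge0 ?extremal_weight_ge0// exprn_ge0.
apply: le_lt_trans
  (integral_fM_double_lty Wu).
apply: ge0_le_integral.
- exact: mD.
- by move=> x _; rewrite lee_fin mulr_ge0 ?extremal_weight_ge0// exprn_ge0.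
- exact/measurable_EFinP.
- exact/measurable_EFinP/measurable_fM_exprn.
- by move=> x _; rewrite lee_fin; exact: fM_double.
Qed.

Lemma extremal_young :
  (K%:E * mu D + \int[mu]_(x in D) (fN n alpha (f x))%:E = A%:E)%E.
Proof.
have [_ _ _ <-] := ext.
have mM : measurable_fun D (fun x => fM n alpha (u x ^+ n)).
  exact: (measurableT_comp (continuous_measurable_fun (@continuous_fM R n alpha n_ge2))
    (measurable_funX _ mu_)).
have mM' : measurable_fun D (fun x => fM n alpha (`|u x| ^+ n)).
  exact: (measurableT_comp (continuous_measurable_fun (@continuous_fM R n alpha n_ge2))
    (measurable_exprn_norm mu_)).
have mN := measurable_fN_comp measurable_extremal_weight.
rewrite (ae_eq_EFin_integral mM mM'); last first.
  by apply: filterS u0 => x + Dx => /(_ Dx) ux0; rewrite ger0_norm.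
rewrite -ge0_integralD.
- rewrite (EFin_Rintegral mD integrable_extremal_mass).
  apply: eq_integral => x _; rewrite -EFinD young_eq ?exprn_ge0//.
  by rewrite mulrC.
- exact: mD.
- by move=> x _; rewrite lee_fin fM_ge0.
- exact/measurable_EFinP.
- by move=> x _; rewrite lee_fin fN_ge0.
- exact/measurable_EFinP.
Qed.

Lemma extremal_mass_gt0 : 0 < A.
Proof.
rewrite -lte_fin -extremal_young; apply: (@lt_le_trans _ _ (K%:E * mu D)%E).
  by rewrite muDE -EFinM lte_fin mulr_gt0.
by apply: leeDl; apply: integral_ge0 => x _; rewrite lee_fin fN_ge0.
Qed.

Lemma extremal_weighted_energy_le w dw : W1n0 D w dw ->
  (\int[mu]_(x in D) (f x * `|w x| ^+ n)%:E <= (energy dw * A)%:E)%E.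
Proof.
move=> Ww; rewrite EFinM -extremal_young.
exact: (weighted_energy_le Ww
  measurable_extremal_weight (fun x _ => extremal_weight_ge0 x)).
Qed.

Let f0 x : 0 <= f x. Proof. exact: extremal_weight_ge0. Qed.

Let mf : measurable_fun D f. Proof. exact: measurable_extremal_weight. Qed.

Let A_gt0 : 0 < A. Proof. exact: extremal_mass_gt0. Qed.

Let iA : mu.-integrable D (EFin \o (fun x => f x * `|u x| ^+ n)).
Proof. exact: integrable_extremal_mass. Qed.

Let mdu i : measurable_fun D (fun x => du x 0 i). Proof. by case: Wu => -[]. Qed.

Let idu : mu.-integrable D (EFin \o (fun x => enorm (du x) ^+ n)).
Proof. by apply: W1n_integrable_gradient; case: Wu; eauto. Qed.

(** The derivative at w = u of f |w|^n / n in the direction psi, the weight f being frozen at the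
    extremal. *)
Definition weighted_product (psi : 'rV[R]_n -> R) x :=
  f x * (`|u x| ^+ (n - 2) * (u x * psi x)).

Let exprn1 (y : R) : y ^+ n.-1 = y ^+ (n - 2) * y.
Proof. by rewrite -exprSr -subSn// subSS subn1. Qed.

(** Where |u| <= 1 the weight is at most M'(1) by monotonicity; elsewhere the exponent n - 1 is
    raised to n. This makes the right-hand side of the equation integrable. *)
Lemma weight_exprn_le x : f x * `|u x| ^+ n.-1 <= dM n alpha 1 + 1 * (f x * `|u x| ^+ n).
Proof.
rewrite mul1r; have [u1|/ltW u1] := leP `|u x| 1.
  apply: (@le_trans _ _ (dM n alpha 1)); last by rewrite lerDl mulr_ge0// exprn_ge0.
  apply: (@le_trans _ _ (f x)); first by rewrite ler_piMr// exprn_ile1.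
  by apply: dM_homo => //; rewrite exprn_ile1.
apply: (@le_trans _ _ (f x * `|u x| ^+ n)); last by rewrite lerDr; exact: dM_ge0.
by rewrite ler_wpM2l// ler_weXn2l// leq_pred.
Qed.

Lemma measurable_weighted_product psi : test_function D psi ->
  measurable_fun D (weighted_product psi).
Proof.
move=> tpsi; apply: (measurable_funM mf).
have mX := measurable_funX (n - 2) (measurableT_comp (@normr_measurable _ setT) mu_).
exact: (measurable_funM mX (measurable_funM mu_ (measurable_test_function tpsi))).
Qed.

Lemma integrable_weighted_product psi : test_function D psi ->
  mu.-integrable D (EFin \o weighted_product psi).
Proof.
move=> tpsi; have [M M0 psiM] := test_function_bounded tpsi.
apply: (@le_integrable_real _ _ _ _ _ mD _
  (fun x => 0 + M * (dM n alpha 1 + 1 * (f x * `|u x| ^+ n)))).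
- exact: measurable_weighted_product.
- move=> x _; rewrite add0r.
  have -> : `|weighted_product psi x| = `|psi x| * (f x * `|u x| ^+ n.-1).
    rewrite /weighted_product normrM (ger0_norm (f0 x)) !normrM normrX normr_id exprn1.
    by ring.
  by apply: ler_pM => //; [rewrite mulr_ge0// exprn_ge0|exact: weight_exprn_le].
- apply: (integrable_realDZ mD _ (integrable_cst_rV openD boundedD 0)).
  exact: (integrable_realDZ mD 1 (integrable_cst_rV openD boundedD (dM n alpha 1)) iA).
Qed.

(** For w = u + c psi the tangent at u bounds the integral of f |w|^n from below, and the tangent at
    dw, evaluated at du, bounds the energy of w from above. Inserted into
    [extremal_weighted_energy_le], the terms A cancel; division by n / (k + 1) leaves a dependence
    on k in the flux alone. *)
Lemma first_variation_le psi (s : R) : test_function D psi -> `|s| <= 1 ->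
  s * \int[mu]_(x in D) weighted_product psi x <=
  A * (s * \int[mu]_(x in D) flux psi du x).
Proof.
move=> tpsi s1.
have step k : s * \int[mu]_(x in D) weighted_product psi x <=
    A * (s * \int[mu]_(x in D) flux psi (perturbed_gradient du psi s k) x).
  pose c := s * k.+1%:R^-1.
  have Ww : W1n0 D (fun x => u x + c * psi x) (perturbed_gradient du psi s k).
    exact: (W1n0_combination n_gt0 openD boundedD c Wu tpsi).
  set w := (fun x => u x + c * psi x) in Ww; have [Ww1 _] := Ww.
  have [mw _ _ _ _] := Ww1.
  set dw := perturbed_gradient du psi s k in Ww Ww1 *.
  have mfw : measurable_fun D (fun x => f x * `|w x| ^+ n).
    exact: (measurable_funM mf (measurable_exprn_norm mw)).
  have Ew := extremal_weighted_energy_le Ww.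
  have ifw : mu.-integrable D (EFin \o (fun x => f x * `|w x| ^+ n)).
    apply: (@ge0_integrable_lty _ _ _ mu D _ mfw _).2.
      by move=> x _; rewrite mulr_ge0// exprn_ge0.
    exact: le_lt_trans Ew (ltry _).
  rewrite -(EFin_Rintegral mD ifw) lee_fin in Ew.
  have iJ := integrable_weighted_product tpsi.
  have iQ := integrable_flux_perturbed mdu idu tpsi s1 k.
  have Jw : A + (n%:R * c) * \int[mu]_(x in D) weighted_product psi x <=
      \int[mu]_(x in D) (f x * `|w x| ^+ n).
    rewrite -(RintegralDZ mD _ iA iJ).
    apply: (le_Rintegral mD (integrable_realDZ mD _ iA iJ) ifw) => x _.
    have := ler_wpM2l (f0 x) (normr_convex (u x) (w x) n_ge2).
    apply: le_trans; rewrite le_eqVlt; apply/orP; left; apply/eqP.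
    by rewrite /weighted_product /w; ring.
  have Gw : energy dw <= 1 + (n%:R * c) * \int[mu]_(x in D) flux psi dw x.
    rewrite -[X in X + _]energy1 -(RintegralDZ mD _ idu iQ).
    apply: (le_Rintegral mD (W1n_integrable_gradient Ww1) (integrable_realDZ mD _ idu iQ)) => x _.
    rewrite -lerBlDr; apply: le_trans (enorm_convex (dw x) (du x) n_ge2).
    have -> : du x - dw x = - c *: gradient psi x.
      by rewrite /dw /perturbed_gradient opprD addNKr scaleNr.
    rewrite dotpZr /flux le_eqVlt; apply/orP; left; apply/eqP.
    by rewrite -/dw; ring.
  move: Jw Gw Ew; rewrite -/dw.
  move: (\int[mu]_(x in D) weighted_product psi x)
    (\int[mu]_(x in D) flux psi dw x) => J Q Jw Gw Ew.
  have H : A + n%:R * c * J <= (1 + n%:R * c * Q) * A.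
    by apply: (le_trans Jw); apply: (le_trans Ew); rewrite ler_wpM2r// ltW.
  have nk : 0 < n%:R * k.+1%:R^-1 :> R by rewrite mulr_gt0// ?invr_gt0 ltr0n.
  rewrite -(ler_pM2l nk) -(lerD2l A).
  have -> : A + n%:R * k.+1%:R^-1 * (s * J) = A + n%:R * c * J by rewrite /c; ring.
  by apply: (le_trans H); rewrite le_eqVlt; apply/orP; left; apply/eqP; rewrite /c; ring.
have cQ := cvg_flux mdu idu tpsi s1.
have cAQ : A * (s * \int[mu]_(x in D) flux psi (perturbed_gradient du psi s k) x) @[k --> \oo] -->
    A * (s * \int[mu]_(x in D) flux psi du x).
  exact: cvgM (cvg_cst _) (cvgM (cvg_cst _) cQ).
by apply: (cvgr_to_ge cAQ); exact: nearW.
Qed.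

Lemma euler_lagrange psi : test_function D psi ->
  \int[mu]_(x in D) weighted_product psi x = A * \int[mu]_(x in D) flux psi du x.
Proof.
move=> tpsi; apply/eqP; rewrite eq_le.
have := first_variation_le (s := 1) tpsi; rewrite normr1 lexx !mul1r => -> //=.
have := first_variation_le (s := -1) tpsi; rewrite normrN1 lexx !mulN1r mulrN lerN2.
exact.
Qed.

Local Notation V := (extremal_potential alpha D u).

Let mdM : measurable_fun D (fun x => dM n alpha (u x ^+ n)).
Proof. exact: (measurableT_comp measurable_dM (measurable_funX _ mu_)). Qed.

Lemma extremal_potentialE x : V x = dM n alpha (u x ^+ n) / A.
Proof.
rewrite /extremal_potential derive1_fM//; congr (_ / _).
rewrite /Rintegral; congr fine; apply: (ae_eq_EFin_integral).
- exact: (measurable_funM mdM (measurable_funX _ mu_)).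
- exact: (measurable_funM mf (measurable_exprn_norm mu_)).
- by apply: filterS u0 => y + Dy => /(_ Dy) uy0; rewrite /extremal_weight ger0_norm.
Qed.

Let VE : V = fun x => dM n alpha (u x ^+ n) / A.
Proof. exact/funext/extremal_potentialE. Qed.

Let mV : measurable_fun D V.
Proof. by rewrite VE; exact: (measurable_funM mdM (measurable_cst _)). Qed.

Lemma extremal_potential_ge0 x : 0 <= V x.
Proof. by rewrite extremal_potentialE divr_ge0 ?dM_ge0// ltW. Qed.

Lemma pos_part_extremal_potential : pos_part V = V.
Proof. by apply/funext => x; rewrite /pos_part max_l// extremal_potential_ge0. Qed.

Lemma extremal_potential_ae : {ae mu, forall x, D x -> V x = f x / A}.
Proof.
apply: filterS u0 => x + Dx => /(_ Dx) ux0.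
by rewrite extremal_potentialE /extremal_weight ger0_norm.
Qed.

Lemma extremal_solution : n_laplace_eq D du (fun x => V x * u x ^+ n.-1).
Proof.
move=> psi tpsi /=; pose g := weighted_product psi.
have ig : mu.-integrable D (EFin \o g).
  exact: (integrable_weighted_product tpsi).
have mg : measurable_fun D g by apply/measurable_EFinP; case/integrableP : ig.
have mr : measurable_fun D (fun x => V x * u x ^+ n.-1 * psi x).
  exact: (measurable_funM (measurable_funM mV (measurable_funX _ mu_))
    (measurable_test_function tpsi)).
have ir : mu.-integrable D (EFin \o (fun x => V x * u x ^+ n.-1 * psi x)).
  apply: (le_integrable mD _ _ (integrableZl mD A^-1 ig)); first exact/measurable_EFinP.
  move=> x _; rewrite -EFinM !abse_EFin lee_fin extremal_potentialE /g /weighted_product.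
  (* Domination is required at every point of D, also where u is negative; monotonicity of [dM]
     covers those points. *)
  have : dM n alpha (u x ^+ n) <= f x.
    by apply: (dM_homo _ alpha_gt0); rewrite -normrX ler_norm.
  move: (dM_ge0 n alpha_gt0 (u x ^+ n)) (f0 x).
  move: (f x) (dM n alpha (u x ^+ n)) => q p p0 q0 pq.
  rewrite exprn1 !normrM !normrX normr_id (ger0_norm p0) (ger0_norm q0).
  rewrite [leRHS](_ : _ = q * `|A^-1| * (`|u x| ^+ (n - 2) * `|u x|) * `|psi x|); last by ring.
  by do 3 (apply: ler_wpM2r; first by rewrite ?mulr_ge0// exprn_ge0).
split=> //.
  exact: (integrable_flux_gradient mdu idu tpsi).
have -> : \int[mu]_(x in D) (V x * u x ^+ n.-1 * psi x) = \int[mu]_(x in D) (A^-1 * g x).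
  rewrite /Rintegral; congr fine; apply: (ae_eq_EFin_integral mr).
    exact: (measurable_funM (measurable_cst _) mg).
  apply: filterS2 u0 extremal_potential_ae => x + + Dx => /(_ Dx) ux0 /(_ Dx) ->.
  by rewrite /g /weighted_product exprn1 (ger0_norm ux0); ring.
rewrite (RintegralZl _ mD ig) /g.
rewrite (euler_lagrange tpsi).
by rewrite mulrA mulVf ?gt_eqF// mul1r.
Qed.

(** The value l = 1 / A attains the infimum: |V| / l is then f almost everywhere, and
    [extremal_young] evaluates the bracket to 1 / (K |D|). The lower bound is [norm_N_ge1] for w =
    u, as both the energy of u and the integral of V |u|^n equal 1. *)
Lemma norm_N_extremal_potential :
  ((K * volume D)%:E * norm_N alpha D K V = 1)%E.
Proof.
apply/eqP; rewrite eq_le; apply/andP; split; last first.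
  apply: (norm_N_ge1 Wu) => //.
    by rewrite energy1.
  rewrite energy1 (ae_eq_EFin_integral (h := fun x => A^-1 * (f x * `|u x| ^+ n))).
  - rewrite -(EFin_Rintegral mD (integrableZl mD A^-1 iA)) (RintegralZl _ mD iA).
    by rewrite lee_fin mulVf ?gt_eqF.
  - exact: (measurable_funM (measurableT_comp (@normr_measurable R setT) mV)
      (measurable_exprn_norm mu_)).
  - exact: (measurable_funM (measurable_cst _) (measurable_funM mf (measurable_exprn_norm mu_))).
  - apply: filterS extremal_potential_ae => x + Dx => /(_ Dx) Vx.
    by rewrite (ger0_norm (extremal_potential_ge0 x)) Vx; ring.
have Ai : 0 < A^-1 by rewrite invr_gt0.
apply: (@le_trans _ _ ((K * volume D)%:E * (A^-1%:E + (A^-1 / (K * volume D))%:E *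
    \int[mu]_(x in D) (fN n alpha (`|V x| / A^-1))%:E))%E).
  apply: lee_wpmul2l; first by rewrite lee_fin ltW.
  by apply: ereal_inf_lbound; exists A^-1.
have mN := measurable_fN_comp mf.
have -> : (\int[mu]_(x in D) (fN n alpha (`|V x| / A^-1))%:E =
    \int[mu]_(x in D) (fN n alpha (f x))%:E)%E.
  apply: (ae_eq_EFin_integral); last 1 first.
  - apply: filterS extremal_potential_ae => x + Dx => /(_ Dx) Vx.
    by rewrite (ger0_norm (extremal_potential_ge0 x)) Vx invrK divfK// gt_eqF.
  - apply: (measurable_fN_comp).
    exact: (measurable_funM (measurableT_comp (@normr_measurable R setT) mV) (measurable_cst _)).
  - exact: mN.
have := extremal_young.
set I := (\int[mu]_(x in D) (fN n alpha (f x))%:E)%E => AE.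
have I0 : (0 <= I)%E by apply: integral_ge0 => x _; rewrite lee_fin fN_ge0.
have Ifin : I \is a fin_num.
  rewrite ge0_fin_numE//; apply: (@le_lt_trans _ _ A%:E); last exact: ltry.
  by rewrite -AE leeDr// muDE -EFinM lee_fin ltW.
move: AE; rewrite -(fineK Ifin) muDE -!EFinM -!EFinD => -[AE].
rewrite lee_fin le_eqVlt; apply/orP; left; apply/eqP.
have := lt0r_neq0 KvolD_gt0; rewrite mulf_eq0 negb_or => /andP[K0 v0].
transitivity (A^-1 * (K * volume D + fine I)); last by rewrite AE mulVf// gt_eqF.
by field; rewrite K0 v0 gt_eqF.
Qed.

End extremal_function.

End moser_trudinger_consequences.

Theorem theorem3p2 (R : realType) (n : nat) (D : set 'rV[R]_n) (alpha K : R)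
    (n_ge2 : (2 <= n)%N) (openD : open D) (boundedD : bounded_set D)
    (alpha_gt0 : 0 < alpha) (alpha_lt : alpha < alpha_crit R n ^+ n)
    (K_optimal : optimal_constant alpha D K) :
  (forall (V u : 'rV[R]_n -> R) (du : 'rV[R]_n -> 'rV[R]_n),
     in_LlogL D V -> W1n0 D u du -> nontrivial D u ->
     n_laplace_eq D du (fun x => V x * `|u x| ^+ (n - 2) * u x) ->
     (1 <= (K * volume D)%:E * norm_N alpha D K (pos_part V))%E)
  /\
  (forall (u : 'rV[R]_n -> R) (du : 'rV[R]_n -> 'rV[R]_n),
     extremal alpha D K u du ->
     let V := extremal_potential alpha D u in
     n_laplace_eq D du (fun x => V x * u x ^+ n.-1) /\
     ((K * volume D)%:E * norm_N alpha D K (pos_part V) = 1)%E).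
Proof.
split=> [V u du VL Wu nu equ|u du ext V].
  exact: (solution_norm_N_ge1 n_ge2 openD boundedD alpha_gt0 K_optimal VL Wu nu equ).
split; first exact: (extremal_solution n_ge2 openD boundedD alpha_gt0 K_optimal ext).
rewrite (pos_part_extremal_potential n_ge2 openD boundedD alpha_gt0 K_optimal ext).
exact: (norm_N_extremal_potential n_ge2 openD boundedD alpha_gt0 K_optimal ext).
Qed.
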